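(* Let $\mu$ be an arbitrary Borel probability measure on $(\mathbb{R}^N,d)$ for which there are $\beta\in[\frac12,1]$ and $c\in(0,\infty)$ such that $$\mu\left(\Phi(|f|)\right)-\Phi(\mu|f|)\le c\,\mu|\nabla f|,\qquad\Phi(x)=x(\log(1+x))^\beta,$$ for all locally Lipschitz $f$, and set $q=\frac1\beta\in[1,2]$. Then there exists a constant $c_q$ such that $$\mu\left(|f|^q\log\frac{|f|^q}{\mu|f|^q}\right)\le c_q\,\mu|\nabla f|^q$$ for all locally Lipschitz $f$.
   Context: $d$ is a metric on $\mathbb{R}^N$; locally Lipschitz and Borel are meant with respect to $d$; $\mu f=\int f\,d\mu$. The length of the gradient of $f:\mathbb{R}^N\to\mathbb{R}$ is $|\nabla f|(x)=\limsup_{d(x,y)\downarrow0}\frac{|f(x)-f(y)|}{d(x,y)}$. Inequalities are understood for those $f$ which are integrable (in the second inequality, $|f|^q$ integrable) and for which the right-hand side is finite; $0\log 0=0\log\frac00=0$. *)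

(* Defs.v *)
From HB Require Import structures.
From mathcomp Require Import all_boot all_order all_algebra.
From mathcomp Require Import all_classical all_reals all_analysis.

Set Implicit Arguments.
Unset Strict Implicit.
Unset Printing Implicit Defensive.

Import Order.TTheory GRing.Theory Num.Theory.
Import numFieldNormedType.Exports.

Local Open Scope classical_set_scope.
Local Open Scope ring_scope.

Record is_metric (R : realType) (T : Type) (d : T -> T -> R) : Prop := IsMetric {
  metric_xx : forall x, d x x = 0 ;
  metric_eq : forall x y, d x y = 0 -> x = y ;
  metric_dC : forall x y, d x y = d y x ;
  metric_tri : forall y x z, d x z <= d x y + d y z
}.

(* The set T carrying the topology of the metric d only. The alias is needed
   because T = 'rV[R]_N already has its own (product) topology, which d is not
   assumed to induce. *)
Definition metrized (R : realType) (T : pointedType) (d : T -> T -> R)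
  (hd : is_metric d) : Type := T.

HB.instance Definition _ (R : realType) (T : pointedType) (d : T -> T -> R)
  (hd : is_metric d) := Pointed.on (metrized hd).
HB.instance Definition _ (R : realType) (T : pointedType) (d : T -> T -> R)
  (hd : is_metric d) := isMetric.Build R (metrized hd)
    (metric_xx hd) (metric_eq hd) (metric_dC hd) (metric_tri hd).

Definition borel (T : ptopologicalType) := g_sigma_algebraType (@open T).

(* Every point has a neighbourhood on which f is Lipschitz. *)
Definition locally_lipschitz (R : realType) (T : metricType R) (f : T -> R) :=
  forall x : T, exists k : R,
    \forall y \near x & z \near x, `|f y - f z| <= k * mdist y z.

(* The punctured limsup of the difference quotients. At an isolated point x the
   filter x^' contains set0 and limf_esup is -oo; the maximum with 0 implements
   the convention that the gradient vanishes there, and changes nothing at the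
   other points, the quotients being nonnegative. *)
Definition grad_length (R : realType) (T : metricType R) (f : T -> R) (x : T)
    : \bar R :=
  maxe 0%E (limf_esup (fun y : T => (`|f x - f y| / mdist x y)%:E) x^').

Definition Phi (R : realType) (beta x : R) : R := x * ln (1 + x) `^ beta.

(* Main.v *)
Require Import Defs.
From HB Require Import structures.
From mathcomp Require Import all_boot all_order all_algebra.
From mathcomp Require Import all_classical all_reals all_analysis.
From mathcomp Require Import measurable_realfun.
From mathcomp Require Import ring lra.

(* Write D for the integral of |grad f|^q.

   Spectral gap. Let g >= 0 be supported in a set A of measure at most 1/2,
   normalised to have integral 1. As Phi is above the line
   (ln 3)^beta (6/5 x - 4/5) on [0, +oo[ and vanishes at 0,
   mu (Phi g) >= (ln 3)^beta (6/5 - 4/5 mu A) >= 4/5 (ln 3)^beta, which exceeds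
   Phi 1 = (ln 2)^beta by a fixed amount; so c mu |grad g| is bounded
   below, that is, mu g <= C mu |grad g|. Applying this to g^q yields
   mu g^q <= C mu |grad g|^q.

   Defective inequality. For g with mu g^q <= 1, the function
   G = g^q (ln (1 + g^q))^(1 - beta) has Phi G comparable to
   X = g^q ln (1 + g^q), while |grad G| <= C X^(1 - beta) |grad g|, which by
   Young's inequality is at most e X + C_e |grad g|^q, and mu G is of order at
   most sqrt (1 + mu X). Hence mu X <= C (1 + mu |grad g|^q).

   Tightening. Let m be a median of f >= 0 and g = |f - m|; the spectral gap
   applies to the positive and negative parts of f - m. Recentring the entropy,
   mu (f^q ln (f^q / mu f^q)) is at most the integral of c theta (f^q / c),
   theta y = y ln y - y + 1, for every c > 0. With c the maximum of m^q and of a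
   multiple of D, this is controlled by g^q and g^q ln (1 + g^q / D).

   The functions G and g^q are truncated away from 0 before being
   differentiated; the chain rule then follows from the growth bound
   l^3 psi u <= psi (l u), l in [0, 1], without derivatives of psi. *)

Set Implicit Arguments.
Unset Strict Implicit.
Unset Printing Implicit Defensive.

Import Order.TTheory GRing.Theory Num.Theory.
Import numFieldNormedType.Exports.

Local Open Scope classical_set_scope.
Local Open Scope ring_scope.

(** * Elementary inequalities *)

Lemma ln_le_subr1 (R : realType) (x : R) : 0 < x -> ln x <= x - 1.
Proof.
move=> x0; have -> : x = 1 + (x - 1) by ring.
by rewrite (le_trans (le_ln1Dx _))//; lra.
Qed.

Lemma ln1D_ge0 (R : realType) (x : R) : 0 <= x -> 0 <= ln (1 + x).
Proof. by move=> x0; rewrite ln_ge0// lerDl. Qed.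

Lemma ler_ln1D (R : realType) (x y : R) : 0 <= x -> x <= y ->
  ln (1 + x) <= ln (1 + y).
Proof. by move=> x0 xy; rewrite ler_ln ?posrE; lra. Qed.

(** Concavity of ln (1 + x), which vanishes at 0. The tangent bound ln z <= z - 1 is used at the two
    ratios [(1 + x) / (1 + l * x)] and [(1 + l * x)^-1]. *)
Lemma ln1D_scale (R : realType) (l x : R) : 0 <= l <= 1 -> 0 <= x ->
  l * ln (1 + x) <= ln (1 + l * x).
Proof.
move=> /andP[l0 l1] x0; have A0 : 0 < 1 + l * x by rewrite ltr_pwDl// mulr_ge0.
have h1 : ln ((1 + x) / (1 + l * x)) <= (1 + x) / (1 + l * x) - 1.
  by apply: ln_le_subr1; rewrite divr_gt0//; lra.
have h2 : ln (1 + l * x)^-1 <= (1 + l * x)^-1 - 1.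
  by apply: ln_le_subr1; rewrite invr_gt0.
rewrite ln_div ?posrE// in h1; last lra.
rewrite lnV ?posrE// in h2.
(* With weights [l] and [1 - l] the right sides of the tangent bounds cancel, as [1 + l * x] is the
   weighted mean of [1 + x] and 1. *)
have : l * ((1 + x) / (1 + l * x) - 1) + (1 - l) * ((1 + l * x)^-1 - 1) = 0.
  by field; lra.
nra.
Qed.

Lemma ln2_ge12 (R : realType) : 1 / 2 <= ln 2 :> R.
Proof.
have := @ln_le_subr1 R 2^-1; rewrite lnV ?posrE// => /(_ _).
by rewrite invr_gt0; lra.
Qed.

Lemma le_powR2r (R : realType) (r x y : R) : 0 <= r -> 0 <= x -> x <= y ->
  x `^ r <= y `^ r.
Proof.
by move=> r0 x0 xy; apply: ge0_ler_powR; rewrite ?nnegrE// (le_trans x0).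
Qed.

(** * Real powers and functions of at most cubic growth *)

Section powers.
Context {R : realType}.
Implicit Types b l u v x y e : R.

(** A crude weighted arithmetic-geometric mean inequality: each factor is at most the same power of
    [x + y]. *)
Lemma powR_mix_le b x y : 0 <= b <= 1 -> 0 <= x -> 0 <= y ->
  x `^ (1 - b) * y `^ b <= x + y.
Proof.
move=> /andP[b0 b1] x0 y0.
have <- : (x + y) `^ (1 - b) * (x + y) `^ b = x + y.
  by rewrite -powRD ?subrK ?powRr1 ?addr_ge0 ?oner_eq0.
rewrite ler_pM ?powR_ge0//; apply: le_powR2r; lra.
Qed.

(* The exponent [1 - 2 b] of the constant is nonpositive, so [e^-1] is enough
   in the second term whatever [b >= 1/2] is. *)
Lemma young_powR b e x y : 1 / 2 <= b <= 1 -> 0 < e <= 1 -> 0 <= x -> 0 <= y ->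
  x `^ (1 - b) * y <= e * x + e^-1 * y `^ (1 / b).
Proof.
move=> /andP[b0 b1] /andP[e0 e1] x0 y0.
have bN0 : b != 0 by apply/eqP => b00; lra.
have b01 : 0 <= b <= 1 by apply/andP; lra.
apply: le_trans (@powR_mix_le b _ _ b01 _ _); last 2 first.
- by rewrite mulr_ge0// ltW.
- by rewrite mulr_ge0 ?powR_ge0// invr_ge0 ltW.
rewrite !powRM ?powR_ge0 ?invr_ge0 ?(ltW e0)//.
rewrite -powRrM div1r mulVf// powRr1// mulrACA ler_peMl ?mulr_ge0 ?powR_ge0//.
rewrite -powR_inv1 ?(ltW e0)// -powRrM -powRD; last by rewrite (gt_eqF e0) implybT.
rewrite -[leLHS](powRr0 e); apply: ger_powR; rewrite ?e0//; lra.
Qed.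

Lemma powR_le_expn l x (n : nat) : 0 <= l <= 1 -> 0 < x -> x <= n%:R ->
  l ^+ n <= l `^ x.
Proof.
move=> /andP[]; rewrite le_eqVlt => /predU1P[<- _ x0 xn|l0 l1 x0 xn].
  rewrite powR0 ?gt_eqF// expr0n; case: eqP => // n0.
  by move: xn; rewrite n0 leNgt x0.
by rewrite -powR_mulrn ?(ltW l0)//; apply: ger_powR => //; rewrite l0.
Qed.

(** A derivative-free substitute for 0 <= psi' <= 3 psi / u: psi u / u^3 is nonincreasing for u > 0.
    The exponent 3 is the largest value of 2 q - 1, which is what [xlog] needs. *)
Definition cubic_growth (psi : R -> R) :=
  {in Num.nneg &, {homo psi : u v / u <= v}} /\
  forall l u, 0 <= l <= 1 -> 0 <= u -> l ^+ 3 * psi u <= psi (l * u).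

Section cubic_growth_theory.
Context (psi : R -> R) (psi_ge0 : forall u, 0 <= psi u).
Context (psiG : cubic_growth psi).

(** With l = u / v, scaling gives psi v - psi u <= (1 - l^3) psi v, and 1 - l^3 <= 3 (1 - l). *)
Lemma cubic_growth_incr u v : 0 < u -> u <= v ->
  0 <= psi v - psi u <= 3 * (psi v / v) * (v - u).
Proof.
move=> u0 uv; have v0 : 0 < v by exact: lt_le_trans uv.
have [mono scal] := psiG.
rewrite subr_ge0 mono ?nnegrE ?(ltW u0) ?(ltW v0)//=.
have l01 : 0 <= u / v <= 1.
  by rewrite (divr_ge0 (ltW u0) (ltW v0))/= ler_pdivrMr// mul1r.
have := scal _ v l01 (ltW v0); rewrite divfK ?gt_eqF// => h.
have -> : 3 * (psi v / v) * (v - u) = 3 * (1 - u / v) * psi v.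
  by field; rewrite gt_eqF.
have := psi_ge0 v; set l := u / v in l01 h *.
case/andP: l01 => l0 l1 p0.
(* This is 3 (1 - l) - (1 - l^3), factored. *)
have l2 : 0 <= (1 - l) ^+ 2 * (2 + l) by rewrite mulr_ge0 ?sqr_ge0//; lra.
have : (1 - l ^+ 3) * psi v <= 3 * (1 - l) * psi v by rewrite ler_wpM2r//; lra.
lra.
Qed.

(** The constant involves the value at [v] alone, as the gradient at one point requires. For u > v,
    halving gives psi u <= 8 psi (u / 2) <= 8 psi v, and 24 = 3 * 8. *)
Lemma cubic_growth_near u v : 0 < v -> 0 < u <= 2 * v ->
  `|psi u - psi v| <= 24 * (psi v / v) * `|u - v|.
Proof.
move=> v0 /andP[u0 uv]; have k0 : 0 <= psi v / v by rewrite divr_ge0 ?(ltW v0).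
have [le_uv|/ltW le_vu] := leP u v.
  have /andP[h1 h2] := cubic_growth_incr u0 le_uv.
  rewrite distrC (distrC u) !ger0_norm ?subr_ge0//; last by rewrite -subr_ge0.
  rewrite (le_trans h2)// ler_wpM2r ?subr_ge0// ler_wpM2r//; lra.
have /andP[h1 h2] := cubic_growth_incr v0 le_vu.
rewrite !ger0_norm ?subr_ge0//; last by rewrite -subr_ge0.
rewrite (le_trans h2)// ler_wpM2r ?subr_ge0//.
suff : psi u / u <= 8 * (psi v / v) by lra.
have [mono scal] := psiG.
have h12 : 0 <= (2^-1 : R) <= 1 by apply/andP; split; lra.
have e8 : 2^-1 ^+ 3 = 8^-1 :> R by field.
have := scal _ u h12 (ltW u0); rewrite e8.
have : psi (2^-1 * u) <= psi v by apply: mono; rewrite ?nnegrE; lra.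
move=> h3 h4; have h : psi u <= 8 * psi v by lra.
rewrite mulrA ler_pM// ?invr_ge0 ?(ltW u0)//.
by rewrite lef_pV2 ?posrE.
Qed.

(** A uniform slope away from 0, which makes compositions locally Lipschitz. *)
Lemma cubic_growth_lip eta M u v : 0 < eta -> eta <= u <= M -> eta <= v <= M ->
  `|psi u - psi v| <= 3 * (psi M / eta) * `|u - v|.
Proof.
move=> eta0; have [mono scal] := psiG.
wlog uv : u v / u <= v => [h uM vM|/andP[eu uM] /andP[ev vM]].
  have [/h|/ltW vu] := leP u v; first exact.
  by rewrite distrC (distrC u); apply: h.
have /andP[h1 h2] := cubic_growth_incr (lt_le_trans eta0 eu) uv.
rewrite distrC (distrC u) !ger0_norm ?subr_ge0//; last by rewrite -subr_ge0.
rewrite (le_trans h2)// ler_wpM2r ?subr_ge0// ler_wpM2l// ler_pM// ?invr_ge0.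
- by rewrite (le_trans (ltW eta0)).
- by apply: mono => //; rewrite nnegrE (le_trans (ltW eta0))// (le_trans ev).
- by rewrite lef_pV2 ?posrE// (lt_le_trans eta0).
Qed.

End cubic_growth_theory.

End powers.

(** * The function [xlog] and the growth of [Phi] *)

Definition xlog {R : realType} (q b u : R) : R :=
  u `^ q * ln (1 + u `^ q) `^ (1 - b).

Section xlog_lemmas.
Context {R : realType} (q b : R) (hb : 1 / 2 <= b <= 1) (hq : q = 1 / b).
Implicit Types u v x y K H : R.

Let b_gt0 : 0 < b. Proof. by case/andP: hb => *; lra. Qed.
Let q_ge1 : 1 <= q.
Proof. by rewrite hq div1r invf_ge1//; case/andP: hb. Qed.
Let q_le2 : q <= 2.
Proof. by rewrite hq div1r invf_ple ?posrE//; case/andP: hb => *; lra. Qed.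
Let q_gt0 : 0 < q. Proof. exact: lt_le_trans q_ge1. Qed.

Lemma mulq1b : q * (1 - b) = q - 1.
Proof. by rewrite hq; field; rewrite gt_eqF. Qed.

Lemma powR_cubic_growth : cubic_growth (fun u => u `^ q).
Proof.
split=> [|l u l01 u0]; first exact: ge0_ler_powR (ltW q_gt0).
have l0 : 0 <= l by case/andP: l01.
rewrite powRM// ler_wpM2r ?powR_ge0//; apply: powR_le_expn => //.
by rewrite (le_trans q_le2)// ler_nat.
Qed.

(** Up to a constant, the derivative of u^q, in the form to which [young_powR] applies. *)
Lemma powR_div u : 0 < u -> u `^ q / u = (u `^ q) `^ (1 - b).
Proof.
move=> u0; rewrite -powRrM mulq1b powRB ?powRr1 ?(ltW u0)//.
by rewrite (gt_eqF u0) implybT.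
Qed.

(** The first factor scales by l^q and, by concavity of ln (1 + x), the second by at least l^(q (1 -
    b)) = l^(q - 1). The total exponent 2 q - 1 is at most 3. *)
Lemma xlog_cubic_growth : cubic_growth (xlog q b).
Proof.
have b1 : 0 <= 1 - b by case/andP: hb => *; lra.
split=> [u v u0 v0 uv|l u l01 u0].
  have uvq : u `^ q <= v `^ q by exact: (le_powR2r (ltW q_gt0)).
  have lnq : 0 <= ln (1 + u `^ q) by rewrite ln1D_ge0 ?powR_ge0.
  apply: ler_pM; [exact: powR_ge0|exact: powR_ge0|exact: uvq|].
  by apply: le_powR2r b1 lnq _; rewrite ler_ln1D ?powR_ge0.
have l0 : 0 <= l by case/andP: l01.
have lq01 : 0 <= l `^ q <= 1.
  case/andP: l01 => _ l1; rewrite powR_ge0/=.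
  by have := le_powR2r (ltW q_gt0) l0 l1; rewrite powR1.
rewrite /xlog powRM//.
have h1 : (l `^ q) `^ (1 - b) * ln (1 + u `^ q) `^ (1 - b) <=
          ln (1 + l `^ q * u `^ q) `^ (1 - b).
  rewrite -powRM ?powR_ge0 ?ln1D_ge0 ?powR_ge0//.
  apply: le_powR2r; rewrite ?mulr_ge0 ?ln1D_ge0 ?mulr_ge0 ?powR_ge0//.
  by rewrite ln1D_scale// powR_ge0.
apply: le_trans (ler_wpM2l _ h1); last by rewrite mulr_ge0 ?powR_ge0.
rewrite [leRHS]mulrACA ler_wpM2r ?mulr_ge0 ?powR_ge0//.
have [->|/negPf ln0] := eqVneq l 0.
  by rewrite expr0n mulr_ge0 ?powR_ge0.
have lgt0 : 0 < l by rewrite lt_def ln0.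
rewrite -powRrM mulq1b -powRD; last by rewrite ln0 implybT.
apply: powR_le_expn => //; move: q_ge1 q_le2 => ? ?; lra.
Qed.

Lemma xlog_ge0 u : 0 <= xlog q b u.
Proof. by rewrite mulr_ge0 ?powR_ge0. Qed.

(** The slope in the chain rule becomes the power 1 - b of the quantity to be bounded, ready for
    [young_powR]. *)
Lemma xlog_div u : 0 < u ->
  xlog q b u / u = (u `^ q * ln (1 + u `^ q)) `^ (1 - b).
Proof.
move=> u0; rewrite powRM ?powR_ge0 ?ln1D_ge0 ?powR_ge0//.
by rewrite -powR_div// /xlog mulrAC.
Qed.

Lemma ln1D_powR_ge12 u : 1 <= u -> 1 / 2 <= ln (1 + u `^ q).
Proof.
move=> u1; rewrite (le_trans (ln2_ge12 R))// (_ : 2 = 1 + 1)//.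
by rewrite ler_ln1D// (le_trans u1)// le1r_powR.
Qed.

(** Since L = ln (1 + u^q) >= 1/2, also L^(1 - b) >= 1/2, and concavity gives ln (1 + xlog u) >= L /
    2. The exponents 1 - b and b of L then add up to 1, with a factor 2^(-b) >= 1/2 left over. *)
Lemma Phi_xlog_ge u : 1 <= u ->
  2^-1 * (u `^ q * ln (1 + u `^ q)) <= Phi b (xlog q b u).
Proof.
move=> u1; have l12 := ln1D_powR_ge12 u1.
have uq0 : 0 <= u `^ q by exact: powR_ge0.
set L := ln _ in l12 *; have b1 : 0 <= 1 - b <= 1 by case/andP: hb => *; lra.
have L12 : 2^-1 <= L `^ (1 - b).
  apply: (@le_trans _ _ (2^-1 `^ (1 - b))).
    by apply: ger1_powR; rewrite ?invr_gt0 ?invf_le1 ?ltr0n ?ler1n//; case/andP: b1.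
  by apply: le_powR2r; lra.
have h : 2^-1 * L <= ln (1 + xlog q b u).
  apply: le_trans (ln1D_scale _ _) _ => //; first by apply/andP; lra.
  rewrite ler_ln1D ?mulr_ge0//.
  by rewrite mulrC ler_wpM2l.
have L0 : 0 < L by lra.
rewrite /Phi.
have {h} : (2^-1 * L) `^ b <= ln (1 + xlog q b u) `^ b.
  by apply: le_powR2r; rewrite ?ln1D_ge0 ?xlog_ge0 ?(ltW b_gt0)//; lra.
rewrite powRM ?(ltW L0)// => h.
have h2 : 2^-1 <= 2^-1 `^ b.
  by apply: ger1_powR; rewrite ?invr_gt0 ?invf_le1 ?ltr0n ?ler1n//; case/andP: hb.
apply: le_trans (ler_wpM2l (xlog_ge0 u) h).
have -> : xlog q b u * (2^-1 `^ b * L `^ b) = 2^-1 `^ b * (u `^ q * L).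
  have LE : L `^ (1 - b) * L `^ b = L.
    by rewrite -powRD ?subrK ?powRr1 ?(ltW L0)// oner_eq0.
  by rewrite /xlog -/L -[in RHS]LE; ring.
by rewrite ler_wpM2r// mulr_ge0// ltW.
Qed.

(** As 1 - b <= 1/2, the logarithmic factor is at most 1 or at most sqrt L, and sqrt L <= K + L / K.
    The free [K] is later set to sqrt (1 + mu X). *)
Lemma xlog_le u K : 1 <= u -> 0 < K ->
  xlog q b u <= u `^ q * (1 + K) + u `^ q * ln (1 + u `^ q) / K.
Proof.
move=> u1 K0; have l12 := ln1D_powR_ge12 u1.
rewrite /xlog; set L := ln _ in l12 *.
rewrite -mulrA -mulrDr ler_wpM2l ?powR_ge0//.
have b1 : 0 <= 1 - b by case/andP: hb => *; lra.
have LK : 0 <= L / K by rewrite divr_ge0 ?(ltW K0)//; lra.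
have [L1|L1] := leP L 1.
  have : L `^ (1 - b) <= 1 `^ (1 - b) by apply: le_powR2r; lra.
  by rewrite powR1; lra.
apply: (@le_trans _ _ (L `^ 2^-1)).
  by apply: ler_powR; [exact: ltW|case/andP: hb => *; lra].
rewrite powR12_sqrt; last by lra.
set s := Num.sqrt L; have s0 : 0 <= s by exact: sqrtr_ge0.
have Ls : L = s ^+ 2 by rewrite sqr_sqrtr//; lra.
apply: (@le_trans _ _ (K + L / K)); last by lra.
rewrite -(ler_pM2l K0) mulrDr mulrCA divff ?gt_eqF// mulr1 Ls.
have := sqr_ge0 (K - s); have := mulr_ge0 (ltW K0) s0; nra.
Qed.

Lemma Phi_homo : {in Num.nneg &, {homo Phi b : x y / x <= y}}.
Proof.
move=> x y; rewrite !nnegrE => x0 y0 xy; rewrite /Phi ler_pM ?powR_ge0//.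
by apply: le_powR2r; rewrite ?ln1D_ge0 ?(ltW b_gt0)// ler_ln1D.
Qed.

Lemma Phi_ge0 x : 0 <= x -> 0 <= Phi b x.
Proof. by move=> x0; rewrite /Phi mulr_ge0 ?powR_ge0. Qed.

(* With s = (1 + H)^(1/4), x <= 5 s^2 gives Phi x <= 35 s^3, which s^4 / 8
   absorbs up to a constant. *)
Lemma Phi_sqrt_le : exists2 k : R, 0 < k & forall x H, 0 <= H ->
  0 <= x <= 5 * Num.sqrt (1 + H) -> Phi b x <= 8^-1 * H + k.
Proof.
(* 280 = 8 * 35 is the value of [s] beyond which 35 s^3 <= s^4 / 8. *)
pose m : R := 280 ^+ 3; have m0 : 0 < m by apply: exprn_gt0; rewrite ltr0n.
exists (8^-1 + 35 * m) => [|x H H0 /andP[x0]]; first lra.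
set s := Num.sqrt (Num.sqrt (1 + H)).
have s2 : Num.sqrt (1 + H) = s ^+ 2 by rewrite sqr_sqrtr// sqrtr_ge0.
have s4 : 1 + H = s ^+ 4 by rewrite (exprM s 2 2) -s2 sqr_sqrtr//; lra.
have s1 : 1 <= s.
  by rewrite -[leLHS]sqrtr1 ler_wsqrtr// -[leLHS]sqrtr1 ler_wsqrtr//; lra.
rewrite s2 => xs.
have -> : H = s ^+ 4 - 1 by lra.
have x1 : 1 + x <= (3 * s) ^+ 2 by rewrite exprMn; nra.
have lx : ln (1 + x) <= 6 * s.
  apply: (@le_trans _ _ (ln ((3 * s) ^+ 2))).
    by rewrite ler_ln ?posrE//; [lra|rewrite exprn_gt0//; lra].
  rewrite lnXn; last by lra.
  have : ln (3 * s) <= 3 * s - 1 by apply: ln_le_subr1; lra.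
  by rewrite mulr2n; lra.
have lb : ln (1 + x) `^ b <= 7 * s.
  have l0 := ln1D_ge0 x0.
  have [l1|l1] := leP (ln (1 + x)) 1.
    have : ln (1 + x) `^ b <= 1 `^ b by exact: le_powR2r (ltW b_gt0) l0 l1.
    by rewrite powR1; lra.
  apply: le_trans (ler1_powR (ltW l1) _) _; last by lra.
  by case/andP: hb.
have : Phi b x <= 5 * s ^+ 2 * (7 * s) by rewrite /Phi ler_pM ?powR_ge0.
have [s280|s280] := leP s 280.
  have : s ^+ 3 <= m by rewrite lerXn2r ?nnegrE; lra.
  have : 0 <= s ^+ 4 by rewrite exprn_ge0; lra.
  by rewrite !exprS expr0; lra.
have : 280 * s ^+ 3 <= s ^+ 4 by rewrite (exprS s 3) ler_wpM2r ?exprn_ge0; lra.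
by rewrite !exprS expr0; lra.
Qed.

End xlog_lemmas.

(** * A line below [Phi] *)

Section Phi_line.
Context {R : realType} (b : R) (hb : 1 / 2 <= b <= 1).

Let b_gt0 : 0 < b. Proof. by case/andP: hb => *; lra. Qed.

Lemma lt_ln_expn (m n : nat) (x y : R) : 0 < x -> 0 < y ->
  x ^+ m < y ^+ n -> m%:R * ln x < n%:R * ln y.
Proof.
move=> x0 y0 xy; rewrite !mulr_natl -!lnXn//.
by rewrite ltr_ln// posrE exprn_gt0.
Qed.

(** Amounts to 2^25 < 3^16. The ratio 16/25 is the square of the 4/5 in [Phi_gap]. *)
Lemma ln2_lt_ln3 : 25 * ln 2 < 16 * ln 3 :> R.
Proof. by apply: lt_ln_expn => //; lra. Qed.

(** Amounts to 3^36 < 5^25. The ratio 36/25 is the square of the 6/5 in [Phi_ge_line]. *)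
Lemma ln3_lt_ln5 : 36 * ln 3 < 25 * ln 5 :> R.
Proof. by apply: lt_ln_expn => //; lra. Qed.

(** The line of [Phi_ge_line], integrated over a set of measure 1/2 against a function of integral
    1, yields 6/5 - 4/5 * 1/2 = 4/5; [Phi b 1] is the term at the mean. *)
Definition Phi_gap : R := ln 3 `^ b * (4 / 5) - Phi b 1.

(** After division by (ln 3)^b the claim is r^b < 4/5 with r = ln 2 / ln 3 < (4/5)^2. As r < 1, the
    exponent 1/2 is the worst. *)
Lemma Phi_gap_gt0 : 0 < Phi_gap.
Proof.
have ln2_gt0 := ln2_ge12 R; have ln23 := ln2_lt_ln3.
have ln3_gt0 : 0 < ln 3 :> R by lra.
set r : R := ln 2 / ln 3.
have r0 : 0 < r by rewrite divr_gt0//; lra.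
have r1 : r < 16 / 25 by rewrite ltr_pdivrMr//; lra.
rewrite subr_gt0 /Phi mul1r; have -> : 1 + 1 = 2 :> R by [].
have -> : ln 2 = ln 3 * r :> R by rewrite mulrC divfK// gt_eqF.
rewrite powRM ?(ltW r0) ?(ltW ln3_gt0)// ltr_pM2l ?powR_gt0//.
apply: (@le_lt_trans _ _ (r `^ 2^-1)).
  by apply: ger_powR; [apply/andP; lra|case/andP: hb => *; lra].
rewrite powR12_sqrt ?(ltW r0)//.
have -> : 4 / 5 = Num.sqrt ((4 / 5) ^+ 2) :> R.
    by rewrite sqrtr_sqr ger0_norm//; lra.
by rewrite expr2 ltr_sqrt; lra.
Qed.

(* The chord of [x |-> ln (1 + x)] over [0, 2] handles [x <= 2]; beyond, the
   exponent [1/2] is the worst one. *)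
Lemma Phi_ge_line (x : R) : 0 <= x ->
  ln 3 `^ b * (6 / 5 * x - 4 / 5) <= Phi b x.
Proof.
move=> x0; have ln2_gt0 := ln2_ge12 R; have ln23 := ln2_lt_ln3.
have ln35 := ln3_lt_ln5.
have ln3_gt0 : 0 < ln 3 :> R by lra.
have l0 := ln1D_ge0 x0.
set r : R := ln (1 + x) / ln 3.
have r0 : 0 <= r by rewrite divr_ge0// ltW.
have lnr : ln (1 + x) = ln 3 * r by rewrite mulrC divfK// gt_eqF.
rewrite /Phi lnr powRM ?(ltW ln3_gt0)// mulrCA ler_wpM2l ?powR_ge0//.
have [x2|x2] := leP x 2.
  have rx : x / 2 <= r.
    have h : 0 <= x / 2 <= 1 by apply/andP; lra.
    have := ln1D_scale h (ler0n R 2); rewrite divfK ?pnatr_eq0//.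
    by rewrite /r ler_pdivlMr// (_ : 1 + 2 = 3)//; lra.
  have r1 : r <= 1.
    rewrite /r ler_pdivrMr// mul1r; have -> : 3 = 1 + 2 :> R by lra.
    by rewrite ler_ln1D.
  have rb : r <= r `^ b.
    have [->|rN0] := eqVneq r 0; first by rewrite powR_ge0.
    by apply: ger1_powR; [rewrite lt_def rN0 r0|case/andP: hb].
  have : x * r <= x * r `^ b by rewrite ler_wpM2l.
  have : x * (x / 2) <= x * r by rewrite ler_wpM2l.
  (* Gives x^2 / 2 >= 6/5 x - 18/25, and 18/25 <= 4/5. *)
  have : 0 <= (x - 6 / 5) ^+ 2 by exact: sqr_ge0.
  rewrite expr2; lra.
have r1 : 1 <= r.
  rewrite /r ler_pdivlMr// mul1r; have -> : 3 = 1 + 2 :> R by lra.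
  by rewrite ler_ln1D//; lra.
have rb1 : 1 <= r `^ b by rewrite -(powRr0 r); apply: ler_powR => //; exact: ltW.
(* Up to 4, r^b >= 1 is enough: x >= 6/5 x - 4/5 means x <= 4. *)
have [x4|x4] := leP x 4.
  have : x * 1 <= x * r `^ b by rewrite ler_wpM2l.
  lra.
(* Beyond 4, ln (1 + x) >= ln 5 raises r^b to at least 6/5, the slope of the line. *)
have r5 : (6 / 5) ^+ 2 <= r.
  rewrite /r ler_pdivlMr//.
  have : ln 5 <= ln (1 + x) by rewrite ler_ln ?posrE//; lra.
  by rewrite expr2; lra.
have : 6 / 5 <= r `^ b.
  apply: (@le_trans _ _ (r `^ 2^-1)); last first.
    by apply: ler_powR => //; case/andP: hb => *; lra.
  rewrite powR12_sqrt//.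
  have -> : 6 / 5 = Num.sqrt ((6 / 5) ^+ 2) :> R.
    by rewrite sqrtr_sqr ger0_norm//; lra.
  by rewrite ler_sqrt// (lt_le_trans _ r1).
move=> /(ler_wpM2l x0); lra.
Qed.

End Phi_line.

(** * The entropy function y ln y - y + 1 *)

Section entropy_function.
Context {R : realType}.
Implicit Types q u x y z m g c B : R.

(** The Bregman divergence of y ln y at 1, which vanishes there to second order. As [ln 0 = 0], its
    value at 0 is the limit 1. *)
Definition theta (y : R) : R := y * ln y - y + 1.

Lemma theta_ge0 y : 0 <= y -> 0 <= theta y.
Proof.
rewrite le_eqVlt => /predU1P[<-|y0]; first by rewrite /theta mul0r; lra.
have := @ln_le_subr1 _ y^-1; rewrite invr_gt0 lnV ?posrE// => /(_ y0) h.
have := ler_wpM2l (ltW y0) h; rewrite mulrBr divff ?gt_eqF// /theta; lra.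
Qed.

Lemma theta_le_sqr y : 0 <= y -> theta y <= (y - 1) ^+ 2.
Proof.
rewrite le_eqVlt => /predU1P[<-|y0]; first by rewrite /theta mul0r expr2; lra.
by have := ler_wpM2l (ltW y0) (ln_le_subr1 y0); rewrite /theta expr2; lra.
Qed.

Lemma ln4_le3 : ln 4 <= 3 :> R.
Proof. by rewrite (le_trans (ln_le_subr1 _))//; lra. Qed.

Lemma theta_le_xlogx y z : 0 <= y <= 4 * (1 + z) -> 0 <= z ->
  theta y <= 1 + 4 * (1 + z) * (3 + ln (1 + z)).
Proof.
move=> /andP[y0 yz] z0; have lz := ln1D_ge0 z0.
have [y1|y1] := leP y 1.
  have : y * ln y <= 0 by rewrite mulr_ge0_le0// ln_le0.
  have : 0 <= 4 * (1 + z) * (3 + ln (1 + z)) by rewrite !mulr_ge0//; lra.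
  rewrite /theta; lra.
have : y * ln y <= 4 * (1 + z) * (3 + ln (1 + z)).
  rewrite ler_pM ?ln_ge0 ?(ltW y1)//.
  apply: (@le_trans _ _ (ln (4 * (1 + z)))); first by rewrite ler_ln ?posrE; lra.
  rewrite lnM ?posrE; [|lra|lra].
  by have := ln4_le3; lra.
rewrite /theta; lra.
Qed.

Lemma powRD_le4 q x y : 1 <= q -> q <= 2 -> 0 <= x -> 0 <= y ->
  (x + y) `^ q <= 4 * (x `^ q + y `^ q).
Proof.
move=> q1 q2 x0 y0; wlog xy : x y x0 y0 / x <= y => [h|].
  have [xy|/ltW yx] := leP x y; first exact: h.
  by rewrite addrC [X in 4 * X]addrC; exact: h.
have q0 : 0 <= q by lra.
apply: (@le_trans _ _ ((2 * y) `^ q)); first by apply: le_powR2r => //; lra.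
rewrite powRM//; apply: (@le_trans _ _ (4 * y `^ q)).
  rewrite ler_wpM2r ?powR_ge0//.
  have -> : 4 = 2 `^ 2 :> R by rewrite (powR_mulrn 2)//; lra.
  by apply: ler_powR => //; lra.
by rewrite ler_wpM2l// lerDr powR_ge0.
Qed.

(** Two regimes for v = |u - 1|: if v <= 1, [theta] is quadratic and v^2 <= v^q; if v > 1, it grows
    like y ln y, with u^q <= 4 v^q. *)
Lemma theta_powR_le q u : 1 <= q -> q <= 2 -> 0 <= u ->
  theta (u `^ q) <=
  32 * (`|u - 1| `^ q + `|u - 1| `^ q * ln (1 + `|u - 1| `^ q)).
Proof.
move=> q1 q2 u0; set v : R := `|u - 1|; have v0 : 0 <= v by exact: normr_ge0.
have vq0 : 0 <= v `^ q by exact: powR_ge0.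
have lv := ln1D_ge0 vq0.
have [v1|v1] := leP v 1.
  have u2 : u <= 2 by move: v1; rewrite /v ler_norml => /andP[_]; lra.
  apply: (@le_trans _ _ (32 * v `^ q)); last by rewrite ler_wpM2l// lerDl mulr_ge0.
  apply: le_trans (theta_le_sqr (powR_ge0 _ _)) _.
  have vv : v ^+ 2 <= v `^ q by apply: powR_le_expn; [rewrite v0|lra|].
  apply: (@le_trans _ _ (32 * v ^+ 2)); last by rewrite ler_wpM2l.
  (* u^q lies between 1 and u^2, and |u^2 - 1| = (u + 1) v <= 3 v. *)
  suff : `|u `^ q - 1| <= 3 * v.
    rewrite -(real_normK (num_real _)) => /(lerXn2r 2 _ _).
    rewrite !nnegrE normr_ge0 mulr_ge0// => /(_ isT isT).
    by rewrite exprMn; have := sqr_ge0 v; lra.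
  have [u1|/ltW u1] := leP u 1.
    have vE : v = 1 - u by rewrite /v distrC ger0_norm//; lra.
    have h1 : u `^ q <= 1.
      by have := le_powR2r (r := q) _ u0 u1; rewrite powR1; apply; lra.
    have h2 : u ^+ 2 <= u `^ q.
      have [->|uN0] := eqVneq u 0; first by rewrite expr0n powR_ge0.
      by apply: powR_le_expn; [rewrite u0|lra|].
    rewrite distrC ger0_norm ?subr_ge0// vE.
    by have := sqr_ge0 (1 - u); rewrite expr2 in h2 *; lra.
  have vE : v = u - 1 by rewrite /v ger0_norm//; lra.
  have h1 : 1 <= u `^ q by rewrite -(powRr0 u); apply: ler_powR => //; lra.
  have h2 : u `^ q <= u ^+ 2.
    by rewrite -powR_mulrn//; apply: ler_powR.
  rewrite ger0_norm ?subr_ge0// vE.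
  have : 0 <= (u - 1) * (2 - u) by rewrite mulr_ge0//; lra.
  by rewrite expr2 in h2; lra.
(* As u >= 0, v > 1 forces u > 2, hence u = 1 + v. *)
have uv : u <= 2 * v.
  move: v1; rewrite /v; case: ger0P; lra.
have y4 : 0 <= u `^ q <= 4 * v `^ q.
  rewrite powR_ge0/=; apply: (@le_trans _ _ ((2 * v) `^ q)).
    by apply: le_powR2r => //; lra.
  rewrite powRM// ler_wpM2r//.
  have -> : 4 = 2 `^ 2 :> R by rewrite (powR_mulrn 2)//; lra.
  by apply: ler_powR => //; lra.
have vq1 : 1 <= v `^ q by rewrite -(powRr0 v); apply: ler_powR; [exact: ltW|lra].
apply: le_trans (theta_le_xlogx (z := v `^ q) _ _) _ => //.
  by case/andP: y4 => -> ?; lra.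
by have := ler_peMl lv vq1; lra.
Qed.

(** If [B] is the maximum, x^q <= 4 (B + g^q) and the growth of [theta] suffices. Otherwise
    homogeneity reduces to [theta_powR_le] at x / m, and putting the smaller [B] for m^q inside the
    logarithm only increases it. *)
Lemma theta_shift_le q m g B : 1 <= q -> q <= 2 -> 0 <= m -> 0 < B ->
  let c := Num.max (m `^ q) B in
  forall x, 0 <= x -> `|x - m| = g ->
  c * theta (x `^ q / c) <=
    13 * B + 32 * (g `^ q + g `^ q * ln (1 + g `^ q / B)).
Proof.
move=> q1 q2 m0 B0 c x x0 gE; have g0 : 0 <= g by rewrite -gE.
have gq0 : 0 <= g `^ q by exact: powR_ge0.
have mq0 : 0 <= m `^ q by exact: powR_ge0.
have lB : 0 <= ln (1 + g `^ q / B) by rewrite ln1D_ge0// divr_ge0// ltW.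
rewrite /c; have [mB|Bm] := leP (m `^ q) B.
  have z0 : 0 <= g `^ q / B by rewrite divr_ge0// ltW.
  have h : 0 <= x `^ q / B <= 4 * (1 + g `^ q / B).
    rewrite divr_ge0 ?powR_ge0 ?(ltW B0)//= ler_pdivrMr//.
    have -> : 4 * (1 + g `^ q / B) * B = 4 * (B + g `^ q).
      by field; rewrite gt_eqF.
    apply: (@le_trans _ _ ((m + g) `^ q)).
      apply: le_powR2r => //; first lra.
      by rewrite -lerBlDl -gE ler_norm.
    by apply: le_trans (powRD_le4 q1 q2 m0 g0) _; lra.
  have := ler_wpM2l (ltW B0) (theta_le_xlogx h z0).
  set l := ln _ in lB *; move=> /le_trans; apply.
  set z := g `^ q / B in z0 h *.
  have -> : g `^ q = B * z by rewrite mulrC divfK// gt_eqF.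
  (* Bounds the term 4 B l by 4 B z = 4 g^q. The constant 13 is 1 + 4 * 3. *)
  have lz : l <= z by rewrite /l -/z (le_trans (ln_le_subr1 _))//; lra.
  have : B * l <= B * z by rewrite ler_wpM2l// ltW.
  have := mulr_ge0 (ltW B0) (mulr_ge0 z0 lB).
  have := mulr_ge0 (ltW B0) z0.
  lra.
have m_gt0 : 0 < m.
  by rewrite lt_def m0 andbT; apply/eqP => me; move: Bm; rewrite me powR0; lra.
have mq_gt0 : 0 < m `^ q by exact: powR_gt0.
have xm : x `^ q / m `^ q = (x / m) `^ q.
  by rewrite powRM ?invr_ge0// -powRN -(powR_inv1 m0) -powRrM mulN1r.
have xm0 : 0 <= x / m by rewrite divr_ge0.
have gm : `|x / m - 1| = g / m.
  have -> : x / m - 1 = (x - m) / m by field; rewrite gt_eqF.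
  by rewrite normrM normfV gE (ger0_norm m0).
have := ler_wpM2l mq0 (theta_powR_le q1 q2 xm0).
rewrite xm gm => /le_trans; apply.
have -> : (g / m) `^ q = g `^ q / m `^ q.
  by rewrite powRM ?invr_ge0// -powRN -(powR_inv1 m0) -powRrM mulN1r.
have : ln (1 + g `^ q / m `^ q) <= ln (1 + g `^ q / B).
  apply: ler_ln1D; first by rewrite divr_ge0.
  by rewrite ler_wpM2l// lef_pV2 ?posrE// ltW.
set l := ln _; move=> /(ler_wpM2l gq0) h.
have -> : m `^ q * (32 * (g `^ q / m `^ q + g `^ q / m `^ q * l)) =
          32 * (g `^ q + g `^ q * l) by field; rewrite gt_eqF.
lra.
Qed.

(** The remainder is affine in [u]; when [A] is the mean of [u], it integrates to A ln (c / A) + A -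
    c <= 0. *)
Lemma entropy_theta u A c : 0 <= u -> 0 < A -> 0 < c ->
  u * ln (u / A) = c * theta (u / c) + (u * (ln (c / A) + 1) - c).
Proof.
move=> u0 A0 c0; rewrite /theta; have [->|uN0] := eqVneq u 0.
  by rewrite !mul0r; ring.
have up : 0 < u by rewrite lt_def uN0.
rewrite !ln_div ?posrE//.
by field; rewrite gt_eqF.
Qed.

End entropy_function.

(** * The length of the gradient *)

Section length_of_gradient.
Context {R : realType} {T : metricType R}.
Implicit Types (f g : T -> R) (x y : T).

Lemma near_mdistP x (P : set T) :
  (\forall y \near x, P y) <->
  exists2 e : R, 0 < e & forall y, mdist x y < e -> P y.
Proof.
split=> [/nbhs_ballP[e /= e0 h]|[e e0 h]].
  by exists e => // y xy; apply: h; rewrite ballEmdist.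
by apply/nbhs_ballP; exists e => //= y; rewrite ballEmdist => /h.
Qed.

(** Clearing the denominator admits y = x, so that isolated points need no separate case. *)
Lemma grad_length_le f x (M : R) : 0 <= M ->
  (grad_length f x <= M%:E)%E <->
  forall e : R, 0 < e -> \forall y \near x, `|f x - f y| <= (M + e) * mdist x y.
Proof.
move=> M0; split=> [h e e0|h].
  have : (limf_esup (fun y => (`|f x - f y| / mdist x y)%:E) x^' < (M + e)%:E)%E.
    apply: (@le_lt_trans _ _ M%:E); last by rewrite lte_fin ltrDl.
    by apply: le_trans h; rewrite /grad_length le_max lexx orbT.
  rewrite /limf_esup => /ereal_inf_lt[_ [V xV <-]] /ltW supV.
  move: xV; rewrite /dnbhs /within /= => xV.
  near=> y; have [->|yx] := eqVneq y x.
    by rewrite subrr normr0 mulr_ge0 ?mdist_ge0// addr_ge0// ltW.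
  have Vy : V y by apply: (near xV y) => //.
  rewrite -ler_pdivrMr ?mdist_gt0 1?eq_sym// -lee_fin.
  by apply: le_trans supV; apply: ereal_sup_ubound; exists y.
rewrite /grad_length ge_max lee_fin M0/=; apply/lee_addgt0Pr => e e0.
rewrite -EFinD; apply: ge_ereal_inf.
exists (ereal_sup ((fun y => (`|f x - f y| / mdist x y)%:E) @`
   [set y | y != x /\ `|f x - f y| <= (M + e) * mdist x y])).
  eexists; last reflexivity.
  by apply: filterS (h e e0) => y /= hy yx.
apply: ge_ereal_sup => _ [y [yx hy] <-].
by rewrite lee_fin ler_pdivrMr// mdist_gt0 eq_sym.
Unshelve. all: by end_near. Qed.

(** By [grad_fin], [fine] loses nothing on locally Lipschitz functions. *)
Definition grad f x : R := fine (grad_length f x).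

Lemma locally_lipschitz_near f x : locally_lipschitz f ->
  exists2 k : R, 0 <= k & \forall y \near x, `|f x - f y| <= k * mdist x y.
Proof.
move=> /(_ x)[k [[A B] /= [xA xB] AB]]; exists (Num.max 0 k).
  by rewrite le_max lexx.
near=> y; apply: (@le_trans _ _ (k * mdist x y)).
  by apply: (AB (x, y)); split => /=; [exact: nbhs_singleton xA|exact: (near xB y)].
by rewrite ler_wpM2r ?mdist_ge0// le_max lexx orbT.
Unshelve. all: by end_near. Qed.

Lemma grad_fin f x : locally_lipschitz f -> grad_length f x = (grad f x)%:E.
Proof.
move=> fL; rewrite /grad fineK// fin_numElt.
have [k k0 hk] := locally_lipschitz_near x fL.
rewrite (@lt_le_trans _ _ 0%E) ?ltNyr//=; last by rewrite /grad_length le_max lexx.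
apply: (@le_lt_trans _ _ k%:E); last exact: ltry.
apply/(grad_length_le _ _ k0) => e e0; apply: filterS hk => y /le_trans; apply.
by rewrite ler_wpM2r ?mdist_ge0// lerDl ltW.
Qed.

Lemma grad_ge0 f x : 0 <= grad f x.
Proof. by rewrite /grad fine_ge0// /grad_length le_max lexx. Qed.

Lemma grad_leP f x (M : R) : locally_lipschitz f -> 0 <= M ->
  (grad f x <= M) <->
  forall e : R, 0 < e -> \forall y \near x, `|f x - f y| <= (M + e) * mdist x y.
Proof.
by move=> fL M0; rewrite -(grad_length_le _ _ M0) (grad_fin _ fL) lee_fin.
Qed.

(** The chain rule as a comparison of increments from the one point [x]. *)
Lemma grad_comp_le f g x (K : R) : locally_lipschitz f -> locally_lipschitz g ->
  0 <= K -> (\forall y \near x, `|g x - g y| <= K * `|f x - f y|) ->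
  grad g x <= K * grad f x.
Proof.
move=> fL gL K0 gf; apply/grad_leP => //; first by rewrite mulr_ge0 ?grad_ge0.
move=> e e0; have K1 : 0 < K + 1 by rewrite ltr_wpDl.
have := (@grad_leP f x (grad f x) fL (grad_ge0 f x)).1 (lexx _) (e / (K + 1)).
rewrite divr_gt0// => /(_ isT) fx; near=> y.
apply: (@le_trans _ _ (K * `|f x - f y|)); first by near: y.
apply: (@le_trans _ _ (K * ((grad f x + e / (K + 1)) * mdist x y))).
  by rewrite ler_wpM2l//; near: y.
rewrite mulrA ler_wpM2r ?mdist_ge0// mulrDr lerD2l mulrA ler_pdivrMr//.
by rewrite mulrDr mulr1 mulrC lerDl ltW.
Unshelve. all: by end_near. Qed.

Lemma locally_lipschitz_comp f g (K : R) : locally_lipschitz f ->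
  (forall x y, `|g x - g y| <= K * `|f x - f y|) -> locally_lipschitz g.
Proof.
move=> fL gf x; have K0 : 0 <= Num.max 0 K by rewrite le_max lexx.
have [k [[A B] /= [xA xB] AB]] := fL x; exists (Num.max 0 K * k).
exists (A, B) => // -[y z] /= yz; rewrite -mulrA.
apply: (@le_trans _ _ (Num.max 0 K * `|f y - f z|)).
  by apply: le_trans (gf _ _) _; rewrite ler_wpM2r// le_max lexx orbT.
by rewrite ler_wpM2l//; exact: (AB (y, z)).
Qed.

Lemma locally_lipschitz_dist_lt f x (e : R) : locally_lipschitz f -> 0 < e ->
  \forall y \near x, `|f x - f y| < e.
Proof.
move=> /(locally_lipschitz_near x)[k k0 hk] e0.
have k1 : 0 < k + 1 by rewrite ltr_wpDl.
have he : \forall y \near x, mdist x y < e / (k + 1).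
  by apply/near_mdistP; exists (e / (k + 1)) => //; rewrite divr_gt0.
near=> y; apply: (@le_lt_trans _ _ (k * mdist x y)); first by near: y.
apply: (@le_lt_trans _ _ ((k + 1) * mdist x y)).
  by rewrite ler_wpM2r ?mdist_ge0// lerDl.
by rewrite mulrC -ltr_pdivlMr//; near: y.
Unshelve. all: by end_near. Qed.

Lemma locally_lipschitz_continuous f : locally_lipschitz f -> continuous f.
Proof.
by move=> fL x; apply/cvgrPdist_lt => e e0; exact: locally_lipschitz_dist_lt.
Qed.

(** A failure at [x] is witnessed by some [y] through two strict inequalities, which the same [y]
    satisfies at all nearby centres. *)
Lemma closed_lip_set f (r a : R) : locally_lipschitz f -> 0 <= a ->
  closed [set x | forall y, mdist x y < r -> `|f x - f y| <= a * mdist x y].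
Proof.
move=> fL a0; rewrite -openC openE => x /= /existsNP[y /not_implyP[xy]].
move=> /negP; rewrite -ltNge => fxy; rewrite /interior /=.
pose s := `|f x - f y| - a * mdist x y; have s0 : 0 < s by rewrite subr_gt0.
have a1 : 0 < a + 1 by rewrite ltr_wpDl.
(* The first bound keeps [y] within [r] of the moved centre. The second spends half of the slack [s]
   on [a * mdist x z]; the variation of [f] takes the other half. *)
pose e := Num.min (r - mdist x y) (s / 2 / (a + 1)).
have e0 : 0 < e by rewrite lt_min subr_gt0 xy/= !divr_gt0.
have hx : \forall z \near x, mdist x z < e by apply/near_mdistP; exists e.
have fx : \forall z \near x, `|f x - f z| < s / 2.
  by apply: locally_lipschitz_dist_lt => //; rewrite divr_gt0.
near=> z; apply/existsNP; exists y; apply/not_implyP; split.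
  apply: (le_lt_trans (metric_triangle _ x _)); rewrite metric_sym.
  have : mdist x z < e by near: z.
  by rewrite /e lt_min => /andP[]; rewrite ltrBrDr.
apply/negP; rewrite -ltNge.
apply: (@le_lt_trans _ _ (a * (mdist x z + mdist x y))).
  by rewrite ler_wpM2l// (le_trans (metric_triangle _ x _))// (metric_sym z).
have h1 : mdist x z < s / 2 / (a + 1).
  by apply: lt_le_trans (_ : mdist x z < e) _; [near: z|rewrite ge_min lexx orbT].
have h2 : a * mdist x z <= s / 2.
  apply: (@le_trans _ _ ((a + 1) * mdist x z)).
    by rewrite ler_wpM2r ?mdist_ge0// lerDl.
  by rewrite mulrC -ler_pdivlMr// ltW.
have h3 : `|f x - f z| < s / 2 by near: z.
have h4 : `|f x - f y| <= `|f x - f z| + `|f z - f y|.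
  by rewrite (_ : f x - f y = (f x - f z) + (f z - f y)) ?ler_normD//; ring.
by rewrite mulrDr; move: h2 h3 h4; rewrite /s; lra.
Unshelve. all: by end_near. Qed.

(** Slack and radius may be taken from countable families. Each set on the right is closed by
    [closed_lip_set], so [grad f] is Borel. *)
Lemma grad_sublevel f (a : R) : locally_lipschitz f -> 0 <= a ->
  [set x | grad f x <= a] = \bigcap_k \bigcup_n [set x | forall y,
    mdist x y < n.+1%:R^-1 -> `|f x - f y| <= (a + k.+1%:R^-1) * mdist x y].
Proof.
move=> fL a0; apply/seteqP; split=> x /=.
  move=> /(grad_leP _ fL a0) h k _.
  have k0 : 0 < k.+1%:R^-1 :> R by rewrite invr_gt0.
  have /near_mdistP[e e0 he] := h _ k0.
  have [n ne] := ltr_add_invr e0; rewrite add0r in ne.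
  by exists n => //= y xy; apply: he; exact: lt_trans ne.
move=> h; apply/grad_leP => // e e0.
have [k ke] := ltr_add_invr e0; rewrite add0r in ke.
have [n _ /= hn] := h k I.
apply/near_mdistP; exists n.+1%:R^-1; first by rewrite invr_gt0.
move=> y /hn /le_trans; apply; rewrite ler_wpM2r ?mdist_ge0//.
by rewrite lerD2l ltW.
Qed.

End length_of_gradient.

Lemma measurable_fun_sublevel d (T : measurableType d) (R : realType)
  (f : T -> R) : (forall a, measurable [set x | f x <= a]) ->
  measurable_fun setT f.
Proof.
move=> h; apply: (measurability _ (measurable_realfun.RGenOInfty.measurableE R)) => //.
move=> /= _ [_ [a ->] <-]; apply: measurableI => //.
rewrite (_ : _ @^-1` _ = ~` [set x | f x <= a]); first exact: measurableC.
by apply/seteqP; split=> x /=; rewrite in_itv/= andbT ltNge => /negP.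
Qed.

(** * Borel measurability of the gradient *)

Section borel_measurability.
Context {R : realType} {T : pointedType} {d : T -> T -> R} (hd : is_metric d).
Local Notation X := (metrized hd).
Implicit Types f : X -> R.

Lemma borel_closed (A : set X) : closed A -> measurable (A : set (borel X)).
Proof.
move=> cA; rewrite -[A]setCK; apply: measurableC.
by apply: sub_sigma_algebra; rewrite openC.
Qed.

Lemma measurable_locally_lipschitz f : locally_lipschitz f ->
  measurable_fun setT (f : borel X -> R).
Proof.
move=> /locally_lipschitz_continuous fc; apply: measurable_fun_sublevel => a.
apply: borel_closed; rewrite (_ : [set x | f x <= a] = f @^-1` [set t | t <= a])//.
by apply: closed_comp => //; exact: closed_le.
Qed.

Lemma measurable_grad f : locally_lipschitz f ->
  measurable_fun setT (grad f : borel X -> R).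
Proof.
move=> fL; apply: measurable_fun_sublevel => a.
have [a0|a0] := leP 0 a; last first.
  rewrite (_ : [set x | _] = set0)//; apply/seteqP; split=> x //= h.
  by have := grad_ge0 f x; rewrite leNgt (le_lt_trans h a0).
rewrite grad_sublevel//; apply: bigcapT_measurable => k.
apply: bigcupT_measurable => n; apply: borel_closed; apply: closed_lip_set => //.
by rewrite addr_ge0// invr_ge0.
Qed.

End borel_measurability.

(** * Integrals and medians *)

Section lipschitz_composition.
Context {R : realType} {T : metricType R}.
Implicit Types (f g w : T -> R) (x y : T).

Lemma lipschitz_comp f g (K : R) : locally_lipschitz f -> 0 <= K ->
  (forall x y, `|g x - g y| <= K * `|f x - f y|) ->
  locally_lipschitz g /\ forall x, grad g x <= K * grad f x.
Proof.
move=> fL K0 gf; have gL := locally_lipschitz_comp fL gf; split=> // x.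
by apply: grad_comp_le => //; exact: nearW.
Qed.

Lemma contraction_comp f g : locally_lipschitz f ->
  (forall x y, `|g x - g y| <= `|f x - f y|) ->
  locally_lipschitz g /\ forall x, grad g x <= grad f x.
Proof.
move=> fL gf; have [||gL h] := @lipschitz_comp f g 1 fL _ _ => //.
  by move=> x y; rewrite mul1r.
by split=> // x; have := h x; rewrite mul1r.
Qed.

(** Keeping [w] above [eta] makes [psi] Lipschitz on its range; subtracting [a] permits a
    composition that vanishes where w = eta. *)
Lemma cubic_growth_comp w (psi : R -> R) (a eta M : R) :
  locally_lipschitz w -> (forall u, 0 <= psi u) -> cubic_growth psi ->
  0 < eta -> (forall x, eta <= w x <= M) ->
  locally_lipschitz (fun x => psi (w x) - a) /\
  forall x, grad (fun x => psi (w x) - a) x <= 24 * (psi (w x) / w x) * grad w x.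
Proof.
move=> wL psi0 psiG eta0 wM.
have subE x y : psi (w x) - a - (psi (w y) - a) = psi (w x) - psi (w y) by ring.
have gL : locally_lipschitz (fun x => psi (w x) - a).
  apply: (locally_lipschitz_comp wL) => x y; rewrite subE.
  exact: cubic_growth_lip (wM x) (wM y).
have w_gt0 x : 0 < w x by case/andP: (wM x) => + _; exact: lt_le_trans.
split=> // x; apply: grad_comp_le => //.
  by rewrite mulr_ge0// divr_ge0// ltW.
(* Near [x], [w y] is below [2 * w x], the range of [cubic_growth_near]. *)
have := locally_lipschitz_dist_lt x wL (w_gt0 x); apply: filterS => y wxy.
rewrite subE distrC (distrC (w x)); apply: cubic_growth_near => //.
rewrite w_gt0/=; move: wxy; rewrite ltr_norml => /andP[+ _]; lra.
Qed.

End lipschitz_composition.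

Section real_integrals.
Context d (T : measurableType d) (R : realType) (P : probability T R).
Implicit Types f g : T -> R.

Local Notation integ f := (P.-integrable setT (EFin \o f)).

Lemma integrable_le f g : measurable_fun setT f -> integ g ->
  (forall x, 0 <= f x <= g x) -> integ f.
Proof.
move=> mf ig fg; apply: (le_integrable measurableT) ig => /=.
  exact/measurable_EFinP.
move=> x _; rewrite lee_fin; have /andP[f0 fgx] := fg x.
by rewrite !ger0_norm// (le_trans f0).
Qed.

Lemma integrable_cst (k : R) : integ (fun=> k).
Proof.
apply: measurable_bounded_integrable => //.
  by rewrite (le_lt_trans (probability_le1 P _))// ltry.
by exists `|k|; split=> // M kM x _ /=; rewrite ltW.
Qed.

Lemma integrable_bounded f (M : R) : measurable_fun setT f ->
  (forall x, 0 <= f x <= M) -> integ f.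
Proof. by move=> mf fM; exact: integrable_le (integrable_cst M) fM. Qed.

Lemma integrable_add f g : integ f -> integ g -> integ (fun x => f x + g x).
Proof. by move=> If Ig; exact: (integrableD measurableT If Ig). Qed.

Lemma integrable_scale (k : R) f : integ f -> integ (fun x => k * f x).
Proof. by move=> If; exact: (integrableZl measurableT k If). Qed.

Lemma Rintegral_le f g : integ f -> integ g -> (forall x, f x <= g x) ->
  \int[P]_x f x <= \int[P]_x g x.
Proof. by move=> If Ig fg; apply: le_Rintegral. Qed.

Lemma RintegralE f : integ f -> (\int[P]_x (f x)%:E)%E = (\int[P]_x f x)%:E.
Proof. by move=> If; rewrite /Rintegral fineK//; exact: integrable_fin_num. Qed.

Lemma Rintegral_prob_cst (k : R) : \int[P]_x k = k.
Proof. by rewrite Rintegral_cst//= probability_setT mulr1. Qed.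

Lemma integrable_ge0 f : measurable_fun setT f -> (forall x, 0 <= f x) ->
  (\int[P]_x (f x)%:E < +oo)%E -> integ f.
Proof.
move=> mf f0 h; apply/integrableP; split; first exact/measurable_EFinP.
by under eq_integral do rewrite /= ger0_norm//.
Qed.

Lemma Rintegral_indic_set (A : set T) : measurable A ->
  integ (\1_A : T -> R) /\ \int[P]_x \1_A x = fine (P A).
Proof.
move=> mA; split; first exact: integrable_indic.
by rewrite /Rintegral integral_indic// setIT.
Qed.

(* [fun n => psi (min (g x) n)] is eventually constant, whence no continuity
   requirement on [psi]. *)
Lemma integral_truncation_le (g : T -> R) (psi : R -> R) (K : R) :
  (forall x, 0 <= g x) -> {in Num.nneg &, {homo psi : u v / u <= v}} ->
  (forall u, 0 <= psi u) -> measurable_fun setT g -> measurable_fun setT psi ->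
  (forall n, \int[P]_x (psi (Num.min (g x) n%:R))%:E <= K%:E)%E ->
  (\int[P]_x (psi (g x))%:E <= K%:E)%E.
Proof.
move=> g0 mono psi0 mg mpsi h.
pose u n x := (psi (Num.min (g x) n%:R))%:E.
have u_lim x : (u^~ x @ \oo --> (psi (g x))%:E)%E.
  apply: cvg_near_cst; near=> n; rewrite /u (min_idPl _)//.
  by near: n; exact: nbhs_infty_ger.
have mu' n : measurable_fun setT (u n).
  apply/measurable_EFinP; apply: (measurableT_comp mpsi).
  exact: measurable_minr.
have u_ge0 n x : setT x -> (0 <= u n x)%E by rewrite lee_fin.
have u_nd x : setT x -> {homo u^~ x : m n / (m <= n)%N >-> (m <= n)%E}.
  move=> _ m n mn; rewrite lee_fin; apply: mono.
  - by rewrite nnegrE le_min g0 ler0n.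
  - by rewrite nnegrE le_min g0 ler0n.
  - by rewrite le_min !ge_min lexx/= ler_nat mn orbT.
have u_cvg : (\int[P]_x u n x @[n --> \oo] --> \int[P]_x (psi (g x))%:E)%E.
  have -> : (\int[P]_x (psi (g x))%:E = \int[P]_x limn (u^~ x))%E.
    by apply: eq_integral => x _; apply/esym/cvg_lim => //; exact: u_lim.
  exact: cvg_monotone_convergence.
rewrite -(cvg_lim _ u_cvg)//; apply: lime_le.
  by apply/cvg_ex; exists (\int[P]_x (psi (g x))%:E)%E.
exact: nearW.
Unshelve. all: by end_near. Qed.

Lemma bigcup_measure_le (F : (set T)^nat) (x : \bar R) :
  (forall n, measurable (F n)) -> nondecreasing_seq F ->
  (forall n, P (F n) <= x)%E -> (P (\bigcup_n F n) <= x)%E.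
Proof.
move=> mF ndF Fx.
have h := nondecreasing_cvg_mu (mu := P) mF (bigcupT_measurable _ mF) ndF.
rewrite -(cvg_lim _ h)//; apply: lime_le; last exact: nearW.
by apply/cvg_ex; exists (P (\bigcup_n F n)).
Qed.

(** The median is the infimum of the levels s >= 0 with P (f > s) <= 1/2. The bounds hold at levels
    strictly above and strictly below it, and reach it by continuity of [P] along increasing
    unions. *)
Lemma median_exists f : measurable_fun setT f -> (forall x, 0 <= f x) ->
  exists2 m : R, 0 <= m &
    (P [set x | (m < f x)%R] <= (1 / 2)%:E)%E /\
    (P [set x | (f x < m)%R] <= (1 / 2)%:E)%E.
Proof.
move=> mf f0.
have mgt s : measurable [set x | s < f x].
  by rewrite -[X in measurable X]setTI -preimage_itvoy; apply: mf.
have mle s : measurable [set x | f x <= s].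
  by rewrite -[X in measurable X]setTI -preimage_itvNyc; apply: mf.
pose S := [set s | 0 <= s /\ (P [set x | (s < f x)%R] <= (1 / 2)%:E)%E].
(* Such levels exist because P (f > n) tends to 0. *)
have S0 : S !=set0.
  have : P [set x | n%:R < f x] @[n --> \oo] --> P (\bigcap_n [set x | n%:R < f x]).
    apply: nonincreasing_cvg_mu => //.
    - by rewrite (le_lt_trans (probability_le1 P _)) ?ltry.
    - exact: bigcapT_measurable.
    - move=> m n mn; apply/subsetPset => x /=; apply: le_lt_trans.
      by rewrite ler_nat.
  have -> : \bigcap_n [set x | n%:R < f x] = set0.
    apply/seteqP; split=> x //= /(_ (Num.truncn (f x)).+1 I)/=.
    by rewrite ltNge (ltW (truncnS_gt _)).
  rewrite measure0 => cvg0; apply: contrapT => S0.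
  have : (limn (fun n => P [set x | (n%:R < f x)%R]) >= (1 / 2)%:E)%E.
    apply: lime_ge; first by apply/cvg_ex; exists 0%E.
    apply: nearW => n; rewrite leNgt; apply/negP => /ltW h.
    by apply: S0; exists n%:R; split.
  by rewrite (cvg_lim _ cvg0)// lee_fin; lra.
have S_inf : has_inf S by split=> //; exists 0 => s [].
have m0 : 0 <= inf S by apply: lb_le_inf => // s [].
have P_gt s : inf S < s -> (P [set x | (s < f x)%R] <= (1 / 2)%:E)%E.
  move=> ms; have [|t [t0 tS]] := @inf_adherent _ S (s - inf S) _ S_inf.
    by rewrite subr_gt0.
  rewrite subrKC => /ltW ts; apply: le_trans tS; apply: le_measure; rewrite ?inE//.
  by move=> x /=; exact: le_lt_trans.
(* A nonnegative level below the infimum is not in [S], so f > s has probability above 1/2; a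
   negative one is below all values of [f]. *)
have P_le s : s < inf S -> (P [set x | (f x <= s)%R] <= (1 / 2)%:E)%E.
  move=> sm; have [s0|s0] := ltP s 0.
    rewrite (_ : [set x | _] = set0) ?measure0 ?lee_fin; first lra.
    by apply/seteqP; split=> x //= fs; have := f0 x; rewrite leNgt (le_lt_trans fs).
  have : ((1 / 2)%:E < P [set x | (s < f x)%R])%E.
    rewrite ltNge; apply/negP => h.
    have : inf S <= s by apply: ge_inf; [exists 0 => ? []|split].
    by rewrite leNgt sm.
  have -> : [set x | s < f x] = ~` [set x | f x <= s].
    by apply/seteqP; split=> x /=; rewrite ltNge => /negP.
  rewrite probability_setC// -(@fineK _ (P [set x | f x <= s])) ?fin_num_measure//.
  by rewrite -EFinB lte_fin lee_fin; lra.
exists (inf S) => //; split.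
  have <- : \bigcup_n [set x | inf S + n.+1%:R^-1 < f x] = [set x | inf S < f x].
    apply/seteqP; split=> [x [n _ /=]|x /= /ltr_add_invr[n nx]]; last by exists n.
    by apply: le_lt_trans; rewrite lerDl invr_ge0.
  apply: bigcup_measure_le => // [n k nk|n]; last first.
    by apply: P_gt; rewrite ltrDl invr_gt0.
  apply/subsetPset => x /=; apply: le_lt_trans.
  by rewrite lerD2l lef_pV2 ?posrE// ler_nat.
have <- : \bigcup_n [set x | f x <= inf S - n.+1%:R^-1] = [set x | f x < inf S].
  apply/seteqP; split=> [x [n _ /=]|x /= /ltr_add_invr[n nx]].
    by move=> /le_lt_trans; apply; rewrite ltrBlDr ltrDl invr_gt0.
  by exists n => //=; rewrite lerBrDr ltW.
apply: bigcup_measure_le => // [n k nk|n]; last first.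
  by apply: P_le; rewrite ltrBlDr ltrDl invr_gt0.
apply/subsetPset => x /= /le_trans; apply.
by rewrite lerD2l lerN2 lef_pV2 ?posrE// ler_nat.
Qed.

End real_integrals.

(** * Spectral gap *)

Lemma maxr_lip (R : realType) (x y a : R) :
  `|Num.max x a - Num.max y a| <= `|x - y|.
Proof.
by case: (leP x a) => xa; case: (leP y a) => ya;
  rewrite ?subrr ?normr0//; case: ger0P => ?; case: ger0P => ?; lra.
Qed.

Lemma minr_lip (R : realType) (x y a : R) :
  `|Num.min x a - Num.min y a| <= `|x - y|.
Proof.
by case: (leP x a) => xa; case: (leP y a) => ya;
  rewrite ?subrr ?normr0//; case: ger0P => ?; case: ger0P => ?; lra.
Qed.

(** Linear arithmetic of [poincare_L1]: [p], [G], [a] and [k] stand for mu (Phi F), mu |grad F|, the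
    measure of the support and [Phi b 1]. *)
Fact poincare_arith (R : realType) (L p G a J k c : R) : c * G <= c * J ->
  L * (4 / 5) * a <= L * (4 / 5) * (1 / 2) ->
  L * (6 / 5) + - (L * (4 / 5)) * a <= p -> p - k <= c * G ->
  L * (4 / 5) - k <= c * J.
Proof. lra. Qed.

(** Half of [W] is absorbed on the left; [E] stands for eta^q. *)
Fact absorb_half (R : realType) (W E K e e' D t : R) : 0 <= W ->
  K * e <= 1 / 2 -> E <= t / 2 -> W - E <= K * (e * W + e' * D) ->
  W <= 2 * (K * e') * D + t.
Proof. by move=> W0 /(ler_wpM2r W0); lra. Qed.

Section Phi_inequality.
Context {R : realType} {T : pointedType} {d : T -> T -> R} (hd : is_metric d).
Context (mu : probability (borel (metrized hd)) R) (b c q : R).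
Local Notation X := (metrized hd).
Implicit Types f g w F : X -> R.

Local Notation integ f := (mu.-integrable setT (fun x : borel X => (f x)%:E)).

Definition Phi_ineq := forall f : X -> R,
  locally_lipschitz f ->
  mu.-integrable setT (fun x => (f x)%:E) ->
  (\int[mu]_x grad_length f x < +oo)%E ->
  (\int[mu]_x (Phi b `|f x|)%:E - (Phi b (\int[mu]_x `|f x|)%R)%:E
     <= c%:E * \int[mu]_x grad_length f x)%E.

Hypotheses (hb : 1 / 2 <= b <= 1) (hc : 0 < c) (hq : q = 1 / b).
Hypothesis hPhi : Phi_ineq.

Lemma measurable_Phi (f : borel X -> R) : measurable_fun setT f ->
  measurable_fun setT (fun x => Phi b (f x)).
Proof.
move=> mf; apply: measurable_funM => //.
apply: (measurableT_comp (measurable_powR _)).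
apply: (measurableT_comp (@measurable_ln R)).
exact: measurable_funD.
Qed.

(** For bounded [F] all terms are finite, which allows computing with real-valued integrals from
    here on. *)
Lemma Phi_ineq_bounded F (M : R) : locally_lipschitz F ->
  (forall x, 0 <= F x <= M) -> integ (grad F) ->
  integ (fun x => Phi b (F x)) /\
  \int[mu]_x Phi b (F x) - Phi b (\int[mu]_x F x) <= c * \int[mu]_x grad F x.
Proof.
move=> FL FM iF; have mF := measurable_locally_lipschitz FL.
have iPhi : integ (fun x => Phi b (F x)).
  apply: (@integrable_bounded _ _ _ mu _ (Phi b M)).
    exact: measurable_Phi.
  move=> x; have /andP[F0 FxM] := FM x; rewrite Phi_ge0//=.
  by apply: (Phi_homo hb) => //; rewrite nnegrE// (le_trans F0).
split=> //; have := hPhi FL (integrable_bounded mu mF FM).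
have -> : (\int[mu]_x grad_length F x = (\int[mu]_x grad F x)%:E)%E.
  by rewrite -(RintegralE iF); apply: eq_integral => x _; rewrite grad_fin.
have -> : (fun x => `|F x|) = F :> (X -> R).
  by apply/funext => x; rewrite ger0_norm//; case/andP: (FM x).
have -> : (\int[mu]_x (Phi b `|F x|)%:E = (\int[mu]_x Phi b (F x))%:E)%E.
  rewrite -(RintegralE iPhi); apply: eq_integral => x _.
  by rewrite ger0_norm//; case/andP: (FM x).
by rewrite ltry => /(_ isT); rewrite -EFinB -EFinM lee_fin.
Qed.

Lemma integrable_grad_le f F (K : R) : locally_lipschitz F -> integ (grad f) ->
  (forall x, grad F x <= K * grad f x) -> integ (grad F).
Proof.
move=> FL If Ff; apply: integrable_le (integrable_scale K If) _.
  exact: measurable_grad.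
by move=> x; rewrite grad_ge0 Ff.
Qed.

Lemma integrable_powR (f : borel X -> R) (M : R) : measurable_fun setT f ->
  (forall x, 0 <= f x <= M) -> integ (fun x => f x `^ q).
Proof.
move=> mf fM; apply: (@integrable_bounded _ _ _ mu _ (M `^ q)).
  exact: (measurableT_comp (@measurable_powR R q)).
have q0 : 0 <= q by rewrite hq divr_ge0//; case/andP: hb => ? _; lra.
by move=> x; have /andP[f0 fM'] := fM x; rewrite powR_ge0/=; exact: le_powR2r.
Qed.

Lemma poincare_L1 g (M : R) : locally_lipschitz g -> (forall x, 0 <= g x <= M) ->
  (mu [set x | (0 < g x)%R] <= (1 / 2)%:E)%E -> integ (grad g) ->
  \int[mu]_x g x <= c / Phi_gap b * \int[mu]_x grad g x.
Proof.
move=> gL gM gA ig; have mg := measurable_locally_lipschitz gL.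
have g0 x : 0 <= g x by case/andP: (gM x).
have gap0 := Phi_gap_gt0 hb.
have Ig := integrable_bounded mu mg gM.
have grad0 : 0 <= \int[mu]_x grad g x.
  by apply: Rintegral_ge0 => x _; exact: grad_ge0.
set I := \int[mu]_x g x.
have : 0 <= I by apply: Rintegral_ge0.
rewrite le_eqVlt => /predU1P[<-|I0].
  by rewrite mulr_ge0// divr_ge0// ltW.
pose F x := I^-1 * g x.
have [FL gradF] : locally_lipschitz F /\ forall x, grad F x <= I^-1 * grad g x.
  apply: (lipschitz_comp gL); first by rewrite invr_ge0 ltW.
  by move=> x y; rewrite -mulrBr normrM ger0_norm// invr_ge0 ltW.
have FM x : 0 <= F x <= I^-1 * M.
  rewrite mulr_ge0 ?invr_ge0 ?(ltW I0)//= ler_wpM2l ?invr_ge0 ?(ltW I0)//.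
  by case/andP: (gM x).
have iF := integrable_grad_le FL ig gradF.
have [iPhi] := Phi_ineq_bounded FL FM iF.
have -> : \int[mu]_x F x = 1 by rewrite RintegralZl// mulVf// gt_eqF.
pose A : set (borel X) := [set x | 0 < g x].
have mA : measurable A.
  rewrite /A -[X in measurable X]setTI -preimage_itvoy; exact: mg.
have [iA intA] := @Rintegral_indic_set _ _ _ mu A mA.
(* Off the support [A] the line is replaced by 0, still below [Phi], so that its constant term is
   charged on [A] only. *)
have hline : ln 3 `^ b * (6 / 5) + - (ln 3 `^ b * (4 / 5)) * fine (mu A) <=
    \int[mu]_x Phi b (F x).
  have -> : ln 3 `^ b * (6 / 5) = \int[mu]_x (ln 3 `^ b * (6 / 5) / I * g x).
    by rewrite RintegralZl// divfK// gt_eqF.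
  rewrite -intA -RintegralZl// -RintegralD//; last 2 first.
  - exact: integrable_scale.
  - exact: integrable_scale.
  apply: Rintegral_le => //.
    by apply: integrable_add; exact: integrable_scale.
  move=> x; rewrite indicE; have [xA|xA] := boolP (x \in A).
    have F0 : 0 <= F x by case/andP: (FM x).
    by apply: le_trans (Phi_ge_line hb F0); rewrite /F/=; lra.
  have -> : g x = 0.
    by apply/eqP; rewrite eq_le g0 andbT leNgt; apply: contra xA; rewrite inE.
  by rewrite !mulr0 addr0 Phi_ge0//; case/andP: (FM x).
have muA : fine (mu A) <= 1 / 2.
  by rewrite -lee_fin fineK// fin_num_measure.
have lnb : 0 <= ln 3 `^ b :> R by exact: powR_ge0.
have h1 : ln 3 `^ b * (4 / 5) * fine (mu A) <= ln 3 `^ b * (4 / 5) * (1 / 2).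
  by rewrite ler_wpM2l// mulr_ge0.
have h2 : \int[mu]_x grad F x <= I^-1 * \int[mu]_x grad g x.
  rewrite -RintegralZl//; apply: Rintegral_le => //.
  exact: integrable_scale.
move=> h3; have h4 : Phi_gap b <= c * (I^-1 * \int[mu]_x grad g x).
  exact: poincare_arith (ler_wpM2l (ltW hc) h2) h1 hline h3.
move: (\int[mu]_x grad g x) h4 => J h4.
rewrite mulrAC ler_pdivlMr; last exact: gap0.
by apply: le_trans (ler_wpM2l (ltW I0) h4) _; rewrite mulrCA mulVKf// gt_eqF.
Qed.

(** The L1 inequality for max (g, eta)^q - eta^q, which vanishes where g <= eta and so inherits the
    small support. Young's inequality splits its gradient. *)
Lemma poincare_Lq_near g (M eta : R) : locally_lipschitz g ->
  (forall x, 0 <= g x <= M) -> 0 < eta <= 1 ->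
  (mu [set x | (0 < g x)%R] <= (1 / 2)%:E)%E ->
  integ (fun x => grad g x `^ q) -> forall e, 0 < e <= 1 ->
  \int[mu]_x Num.max (g x) eta `^ q - eta `^ q <=
  24 * (c / Phi_gap b) * (e * \int[mu]_x Num.max (g x) eta `^ q +
                          e^-1 * \int[mu]_x grad g x `^ q).
Proof.
move=> gL gM /andP[eta0 eta1] gA ig e e01.
set W := \int[mu]_x Num.max _ _ `^ q.
have e_ge0 : 0 <= e by case/andP: e01 => /ltW.
pose w x := Num.max (g x) eta.
have [wL gradw] : locally_lipschitz w /\ forall x, grad w x <= grad g x.
  by apply: contraction_comp => // x y; exact: maxr_lip.
have w_eta x : eta <= w x <= M + 1.
  have /andP[g0 gM'] := gM x; rewrite /w le_max lexx orbT/= ge_max; lra.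
have w_gt0 x : 0 < w x by case/andP: (w_eta x) => + _; exact: lt_le_trans.
pose G x := w x `^ q - eta `^ q.
have [GL gradG] : locally_lipschitz G /\
    forall x, grad G x <= 24 * (w x `^ q / w x) * grad w x.
  apply: (cubic_growth_comp (psi := fun u => u `^ q)) wL _ _ eta0 w_eta.
  - by move=> u; exact: powR_ge0.
  - exact: (powR_cubic_growth hb hq).
have q0 : 0 <= q by rewrite hq divr_ge0//; case/andP: hb => ? _; lra.
have mw : measurable_fun setT (fun x : borel X => w x `^ q).
  apply: (measurableT_comp (@measurable_powR R q)).
  exact: measurable_locally_lipschitz.
have Iw : integ (fun x => w x `^ q).
  apply: (integrable_bounded mu mw (M := (M + 1) `^ q)) => x; rewrite powR_ge0/=.
  by apply: le_powR2r => //; [exact: ltW|case/andP: (w_eta x)].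
have GM x : 0 <= G x <= (M + 1) `^ q.
  have /andP[h1 h2] := w_eta x; have w0 := w_gt0 x.
  have : eta `^ q <= w x `^ q by apply: le_powR2r => //; exact: ltW.
  have : w x `^ q <= (M + 1) `^ q by apply: le_powR2r => //; exact: ltW.
  by have := powR_ge0 eta q; rewrite /G; lra.
pose Y x := 24 * (e * w x `^ q + e^-1 * grad g x `^ q).
have IY : integ Y.
  by apply: integrable_scale; apply: integrable_add; exact: integrable_scale.
have GY x : grad G x <= Y x.
  apply: le_trans (gradG x) _; rewrite /Y -mulrA ler_wpM2l//.
  apply: (@le_trans _ _ ((w x `^ q) `^ (1 - b) * grad g x)).
    rewrite (powR_div hb hq)// ler_wpM2l ?powR_ge0//.
  by rewrite hq; apply: young_powR; rewrite ?powR_ge0 ?grad_ge0.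
have IG : integ (grad G).
  apply: integrable_le IY _; first exact: measurable_grad.
  by move=> x; rewrite grad_ge0 GY.
have GA : (mu [set x | (0 < G x)%R] <= (1 / 2)%:E)%E.
  apply: le_trans gA; apply: le_measure; rewrite ?inE.
  - rewrite -[X in measurable X]setTI -preimage_itvoy.
    exact: (measurable_locally_lipschitz GL).
  - rewrite -[X in measurable X]setTI -preimage_itvoy.
    exact: (measurable_locally_lipschitz gL).
  - move=> x /=; rewrite !ltNge; apply: contra => gx0.
    by rewrite /G /w (max_idPr _) ?subrr// (le_trans gx0)// ltW.
have := poincare_L1 GL GM GA IG.
have -> : \int[mu]_x G x = W - eta `^ q.
  by rewrite RintegralB// ?Rintegral_prob_cst//; exact: integrable_cst.
move=> /le_trans; apply.
have h : \int[mu]_x grad G x <= \int[mu]_x Y x by apply: Rintegral_le.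
have YE : \int[mu]_x Y x = 24 * (e * W + e^-1 * \int[mu]_x grad g x `^ q).
  rewrite RintegralZl//; last first.
    by apply: integrable_add; exact: integrable_scale.
  rewrite RintegralD//; [|exact: integrable_scale|exact: integrable_scale].
  by rewrite (RintegralZl _ measurableT Iw) (RintegralZl _ measurableT ig).
rewrite (mulrC 24) -[leRHS]mulrA -YE ler_wpM2l//.
by rewrite divr_ge0// ltW// Phi_gap_gt0.
Qed.

(** [e] is fixed so as to absorb the power term on the left; then [eta] is taken arbitrarily
    small. *)
Lemma poincare_Lq : exists2 K : R, 0 < K & forall g (M : R), locally_lipschitz g ->
  (forall x, 0 <= g x <= M) ->
  (mu [set x | (0 < g x)%R] <= (1 / 2)%:E)%E ->
  integ (fun x => grad g x `^ q) ->
  \int[mu]_x g x `^ q <= K * \int[mu]_x grad g x `^ q.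
Proof.
have gap0 := Phi_gap_gt0 hb.
pose K := 24 * (c / Phi_gap b); have K0 : 0 < K by rewrite mulr_gt0// divr_gt0.
(* Chosen to have both [e <= 1] and [K * e <= 1 / 2]. *)
pose e := (1 + 2 * K)^-1; have e0 : 0 < e by rewrite invr_gt0; lra.
have e01 : 0 < e <= 1 by rewrite e0/= invf_le1; lra.
exists (2 * (K * e^-1)); first by rewrite !mulr_gt0// invr_gt0.
move=> g M gL gM gA ig; set D := \int[mu]_x grad g x `^ q.
have q1 : 1 <= q by rewrite hq div1r invf_ge1//; case/andP: hb => *; lra.
have Ke : K * e <= 1 / 2 by rewrite /e -/(K / (1 + 2 * K)) ler_pdivrMr; lra.
(* As eta <= 1 <= q, eta^q <= eta <= t / 2. *)
apply/ler_addgt0Pr => t t0; pose eta := Num.min 1 (t / 2).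
have eta01 : 0 < eta <= 1 by rewrite /eta lt_min ltr01 divr_gt0//= ge_min lexx.
have := poincare_Lq_near gL gM eta01 gA ig e01.
rewrite -/K; set W := \int[mu]_x _; rewrite -/D => h.
have W0 : 0 <= W by apply: Rintegral_ge0 => x _; exact: powR_ge0.
have etat : eta `^ q <= t / 2.
  by apply: (le_trans (ge1r_powR eta01 q1)); rewrite ge_min lexx orbT.
apply: le_trans (absorb_half W0 Ke etat h).
have eta0 : 0 <= eta by case/andP: eta01 => /ltW.
have q0 : 0 <= q by rewrite (le_trans _ q1).
apply: Rintegral_le.
- exact: integrable_powR (measurable_locally_lipschitz gL) gM.
- apply: (integrable_powR _ (M := M + 1)).
    by apply: measurable_maxr => //; exact: measurable_locally_lipschitz.
  move=> x; have /andP[g0 gM'] := gM x; rewrite le_max g0/= ge_max.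
  rewrite (le_trans gM') ?lerDl//=; case/andP: eta01 => _ /le_trans; apply.
  by rewrite lerDr (le_trans g0).
- move=> x; apply: le_powR2r => //; first by case/andP: (gM x).
  by rewrite le_max lexx.
Qed.

End Phi_inequality.

(** * Defective logarithmic Sobolev inequality *)

(** [H], [P], [S], [I] stand for mu X, mu (Phi G), Phi (mu G), mu |grad G|. Taking two terms H / 8
    away from H / 2 leaves H / 4. *)
Fact absorb_quarter (R : realType) (H D P S k c e e' I : R) : 0 <= H -> 0 <= D ->
  2^-1 * H <= P -> P - S <= c * I -> S <= 8^-1 * H + k ->
  c * I <= c * (24 * (e * H + e' * D)) -> 24 * c * e <= 8^-1 -> 0 <= c * e' ->
  0 <= k -> H <= (4 * k + 96 * (c * e')) * (1 + D).
Proof.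
move=> H0 D0 h1 h2 h3 h4 /(ler_wpM2r H0) h5 ce' k0.
have := mulr_ge0 k0 D0; have := mulr_ge0 ce' D0; lra.
Qed.

Section log_sobolev.
Context {R : realType} {T : pointedType} {d : T -> T -> R} (hd : is_metric d).
Context (mu : probability (borel (metrized hd)) R) (b c q : R).
Local Notation X := (metrized hd).
Implicit Types f g w F : X -> R.

Local Notation integ f := (mu.-integrable setT (fun x : borel X => (f x)%:E)).

Hypotheses (hb : 1 / 2 <= b <= 1) (hc : 0 < c) (hq : q = 1 / b).
Hypothesis hPhi : Phi_ineq mu b c.

Definition xlogx (u : R) : R := u `^ q * ln (1 + u `^ q).

Lemma xlogx_ge0 u : 0 <= xlogx u.
Proof. by rewrite mulr_ge0 ?ln1D_ge0 ?powR_ge0. Qed.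

Lemma xlogx_homo u v : 0 <= u -> u <= v -> xlogx u <= xlogx v.
Proof.
move=> u0 uv; have q0 : 0 <= q by rewrite hq divr_ge0//; case/andP: hb => ? _; lra.
have h : u `^ q <= v `^ q by exact: le_powR2r.
apply: ler_pM; [exact: powR_ge0|by rewrite ln1D_ge0 ?powR_ge0|exact: h|].
by apply: ler_ln1D h; exact: powR_ge0.
Qed.

Lemma measurable_xlogx : measurable_fun setT xlogx.
Proof.
apply: measurable_funM; first exact: measurable_powR.
apply: (measurableT_comp (@measurable_ln R)).
by apply: measurable_funD => //; exact: measurable_powR.
Qed.

Lemma integrable_xlogx (f : borel X -> R) (M : R) : measurable_fun setT f ->
  (forall x, 0 <= f x <= M) -> integ (fun x => xlogx (f x)).
Proof.
move=> mf fM; apply: (@integrable_bounded _ _ _ mu _ (xlogx M)).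
  exact: (measurableT_comp measurable_xlogx).
by move=> x; have /andP[f0 fM'] := fM x; rewrite xlogx_ge0 xlogx_homo.
Qed.

(** Truncation from below at 1 costs a constant only, since w^q <= g^q + 1, and puts [w] in the
    range u >= 1 of [Phi_xlog_ge] and [xlog_le]. *)
Lemma xlogx_grad_le g (M e k : R) : 0 < k ->
  (forall x H, 0 <= H -> 0 <= x <= 5 * Num.sqrt (1 + H) ->
    Phi b x <= 8^-1 * H + k) ->
  locally_lipschitz g ->
  (forall x, 0 <= g x <= M) ->
  \int[mu]_x g x `^ q <= 1 -> integ (fun x => grad g x `^ q) -> 0 < e <= 1 ->
  24 * c * e <= 8^-1 ->
  \int[mu]_x xlogx (Num.max (g x) 1) <=
  (4 * k + 96 * (c * e^-1)) *
  (1 + \int[mu]_x grad g x `^ q).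
Proof.
move=> k0 hk gL gM g1 ig e01 ce; have e0 : 0 < e by case/andP: e01.
pose w x := Num.max (g x) 1.
have [wL gradw] : locally_lipschitz w /\ forall x, grad w x <= grad g x.
  by apply: contraction_comp => // x y; exact: maxr_lip.
have w_ge1 x : 1 <= w x by rewrite le_max lexx orbT.
have w_gt0 x : 0 < w x by exact: lt_le_trans (w_ge1 x).
have w_M x : w x <= M + 1.
  by have /andP[g0 gM'] := gM x; rewrite ge_max; apply/andP; split; lra.
have w_0M x : 0 <= w x <= M + 1 by rewrite w_M ltW.
have w_1M x : 1 <= w x <= M + 1 by rewrite w_M w_ge1.
have mw : measurable_fun setT (w : borel X -> R).
  exact: measurable_locally_lipschitz.
have q1 : 1 <= q by rewrite hq div1r invf_ge1//; case/andP: hb => *; lra.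
have q0 : 0 <= q by rewrite (le_trans _ q1).
have Iwq := integrable_powR mu hb hq mw w_0M.
have Igq := integrable_powR mu hb hq (measurable_locally_lipschitz gL) gM.
have IX := integrable_xlogx mw w_0M.
set H := \int[mu]_x xlogx (w x).
have H0 : 0 <= H by apply: Rintegral_ge0 => x _; exact: xlogx_ge0.
pose G x := xlog q b (w x).
have [GL gradG] : locally_lipschitz G /\
    forall x, grad G x <= 24 * (xlog q b (w x) / w x) * grad w x.
  have := cubic_growth_comp 0 wL (xlog_ge0 q b) (xlog_cubic_growth hb hq) ltr01 w_1M.
  have -> // : (fun x => xlog q b (w x) - 0) = G.
  by apply/funext => x; rewrite subr0.
have GM x : 0 <= G x <= xlog q b (M + 1).
  rewrite xlog_ge0/=; have [+ _] := xlog_cubic_growth hb hq; apply => //.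
    by rewrite nnegrE ltW.
  by rewrite nnegrE (le_trans _ (w_M x))// ltW.
pose Y x := 24 * (e * xlogx (w x) + e^-1 * grad g x `^ q).
have IY : integ Y.
  by apply: integrable_scale; apply: integrable_add; exact: integrable_scale.
have GY x : grad G x <= Y x.
  apply: le_trans (gradG x) _; rewrite /Y -mulrA ler_wpM2l//.
  apply: (@le_trans _ _ (xlogx (w x) `^ (1 - b) * grad g x)).
    by rewrite (xlog_div hb hq)// ler_wpM2l ?powR_ge0.
  by rewrite [in leRHS]hq; apply: young_powR; rewrite ?xlogx_ge0 ?grad_ge0.
have IG : integ (grad G).
  apply: integrable_le IY _; first exact: measurable_grad.
  by move=> x; rewrite grad_ge0 GY.
have [IPhi hG] := Phi_ineq_bounded hb hPhi GL GM IG.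
have YE : \int[mu]_x Y x = 24 * (e * H + e^-1 * \int[mu]_x grad g x `^ q).
  rewrite RintegralZl//; last first.
    by apply: integrable_add; exact: integrable_scale.
  rewrite RintegralD//; [|exact: integrable_scale|exact: integrable_scale].
  by rewrite (RintegralZl _ measurableT IX) (RintegralZl _ measurableT ig).
have cG : c * \int[mu]_x grad G x <=
    c * (24 * (e * H + e^-1 * \int[mu]_x grad g x `^ q)).
  by rewrite -YE ler_wpM2l ?(ltW hc)//; exact: Rintegral_le.
have HPhi : 2^-1 * H <= \int[mu]_x Phi b (G x).
  rewrite -(RintegralZl _ measurableT IX); apply: Rintegral_le => //.
    exact: integrable_scale.
  by move=> x; exact: (Phi_xlog_ge hb hq).
have wq2 : \int[mu]_x w x `^ q <= 2.
  apply: (@le_trans _ _ (\int[mu]_x (g x `^ q + 1))).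
    apply: Rintegral_le => //.
      by apply: integrable_add => //; exact: integrable_cst.
    move=> x; rewrite /w; case: (leP (g x) 1) => _.
      by rewrite powR1 lerDr powR_ge0.
    by rewrite lerDl.
  rewrite RintegralD// ?Rintegral_prob_cst; last exact: integrable_cst.
  by rewrite -[2]/(1 + 1) lerD2r.
(* [xlog_le] is used with K = s, the square root of 1 + H: H / s <= s and mu w^q <= 2 give 2 (1 + s)
   + s <= 5 s, as s >= 1. *)
have Gsqrt : 0 <= \int[mu]_x G x <= 5 * Num.sqrt (1 + H).
  rewrite Rintegral_ge0/=; last by move=> x _; exact: xlog_ge0.
  set s := Num.sqrt (1 + H).
  have s1 : 1 <= s.
    by rewrite -[leLHS]sqrtr1 ler_wsqrtr// -[leLHS]addr0 lerD2l.
  have s0 : 0 < s by exact: lt_le_trans s1.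
  apply: (@le_trans _ _ (\int[mu]_x ((1 + s) * w x `^ q + s^-1 * xlogx (w x)))).
    apply: Rintegral_le.
    - exact: integrable_bounded (measurable_locally_lipschitz GL) GM.
    - by apply: integrable_add; exact: integrable_scale.
    - by move=> x; rewrite (mulrC (1 + s)) (mulrC s^-1); exact: (xlog_le hb hq).
  rewrite RintegralD//; [|exact: integrable_scale|exact: integrable_scale].
  rewrite (RintegralZl _ measurableT IX) (RintegralZl _ measurableT Iwq) -/H.
  have Hs : s^-1 * H <= s.
    rewrite mulrC ler_pdivrMr// -expr2 sqr_sqrtr ?addr_ge0//.
    by rewrite lerDr.
  apply: (@le_trans _ _ ((1 + s) * 2 + s)).
    by rewrite lerD// ler_wpM2l// addr_ge0// ltW.
  have -> : (1 + s) * 2 + s = 2 * 1 + 3 * s by ring.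
  have -> : 5 * s = 2 * s + 3 * s by ring.
  by rewrite lerD2r ler_wpM2l.
have := hk _ _ H0 Gsqrt.
move: hG HPhi cG => h1 h2 h3 h4.
apply: absorb_quarter H0 _ h2 h1 h4 h3 ce _ _.
- by apply: Rintegral_ge0 => x _; exact: powR_ge0.
- by rewrite mulr_ge0 ?invr_ge0 ?(ltW hc) ?(ltW e0).
- exact: ltW.
Qed.

End log_sobolev.

(** * Removal of the boundedness assumption *)

Section unbounded.
Context {R : realType} {T : pointedType} {d : T -> T -> R} (hd : is_metric d).
Context (mu : probability (borel (metrized hd)) R) (b c q : R).
Local Notation X := (metrized hd).
Implicit Types f g w F : X -> R.

Local Notation integ f := (mu.-integrable setT (fun x : borel X => (f x)%:E)).

Hypotheses (hb : 1 / 2 <= b <= 1) (hc : 0 < c) (hq : q = 1 / b).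
Hypothesis hPhi : Phi_ineq mu b c.

Let q_ge1 : 1 <= q.
Proof. by rewrite hq div1r invf_ge1//; case/andP: hb => *; lra. Qed.

Let q_ge0 : 0 <= q. Proof. by rewrite (le_trans _ q_ge1). Qed.

Lemma grad_powR_le F f : locally_lipschitz F ->
  (forall x, grad F x <= grad f x) -> integ (fun x => grad f x `^ q) ->
  integ (fun x => grad F x `^ q) /\
  \int[mu]_x grad F x `^ q <= \int[mu]_x grad f x `^ q.
Proof.
move=> FL Ff If.
have le x : 0 <= grad F x `^ q <= grad f x `^ q.
  by rewrite powR_ge0/= le_powR2r// grad_ge0.
have IF : integ (fun x => grad F x `^ q).
  apply: integrable_le If le.
  by apply: (measurableT_comp (@measurable_powR R q)); exact: measurable_grad.
by split; [exact: IF|apply: (Rintegral_le IF If) => x; case/andP: (le x)].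
Qed.

Lemma trunc_lipschitz (s : X -> R) n : locally_lipschitz s ->
  (forall x, 0 <= s x) ->
  let u x := Num.min (s x) n%:R in
  [/\ locally_lipschitz u, forall x, grad u x <= grad s x &
      forall x, 0 <= u x <= n%:R].
Proof.
move=> sL s0 u; have [uL gradu] : locally_lipschitz u /\ forall x, grad u x <= grad s x.
  by apply: contraction_comp => // x y; exact: minr_lip.
by split=> // x; rewrite /u le_min s0 ler0n/= ge_min lexx orbT.
Qed.

(** Monotone convergence: a bound uniform in the truncation level yields integrability along with
    the estimate. *)
Lemma Rintegral_truncation_le (s : X -> R) (psi : R -> R) (K : R) :
  locally_lipschitz s -> (forall x, 0 <= s x) ->
  {in Num.nneg &, {homo psi : u v / u <= v}} ->
  (forall u, 0 <= psi u) -> measurable_fun setT psi ->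
  (forall n, \int[mu]_x psi (Num.min (s x) n%:R) <= K) ->
  integ (fun x => psi (s x)) /\ \int[mu]_x psi (s x) <= K.
Proof.
move=> sL s0 mono psi0 mpsi hK; have ms := measurable_locally_lipschitz sL.
have I n : integ (fun x => psi (Num.min (s x) n%:R)).
  have [uL _ un] := trunc_lipschitz n sL s0.
  apply: (@integrable_bounded _ _ _ mu _ (psi n%:R)).
    by apply: (measurableT_comp mpsi); exact: measurable_locally_lipschitz.
  by move=> x; have /andP[u0 u1] := un x; rewrite psi0/= mono ?nnegrE//.
have h : (\int[mu]_x (psi (s x))%:E <= K%:E)%E.
  apply: integral_truncation_le => // n.
  by rewrite (RintegralE (I n)) lee_fin.
have Is : integ (fun x => psi (s x)).
  apply: integrable_ge0 => //; first exact: (measurableT_comp mpsi).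
  exact: le_lt_trans h (ltry _).
by split=> //; rewrite -lee_fin -(RintegralE Is).
Qed.

(** Truncation from above enlarges neither the gradient nor the support, so the constant of
    [poincare_Lq] is kept. *)
Lemma poincare : exists2 K : R, 0 < K & forall s, locally_lipschitz s ->
  (forall x, 0 <= s x) -> (mu [set x | (0 < s x)%R] <= (1 / 2)%:E)%E ->
  integ (fun x => grad s x `^ q) ->
  integ (fun x => s x `^ q) /\
  \int[mu]_x s x `^ q <= K * \int[mu]_x grad s x `^ q.
Proof.
have [K K0 hK] := poincare_Lq hb hc hq hPhi; exists K => // s sL s0 sA ig.
apply: (Rintegral_truncation_le (psi := fun u => u `^ q) sL s0).
- exact: ge0_ler_powR.
- by move=> u; exact: powR_ge0.
- exact: measurable_powR.
move=> n; have [uL gradu un] := trunc_lipschitz n sL s0.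
have [iu hu] := grad_powR_le uL gradu ig.
apply: le_trans (hK _ _ uL un _ iu) _; last by rewrite ler_wpM2l// ltW.
apply: le_trans sA; apply: le_measure; rewrite ?inE.
- rewrite -[X in measurable X]setTI -preimage_itvoy.
  exact: (measurable_locally_lipschitz uL).
- rewrite -[X in measurable X]setTI -preimage_itvoy.
  exact: (measurable_locally_lipschitz sL).
- by move=> x /=; rewrite lt_min => /andP[].
Qed.

Let b_neq0 : b != 0.
Proof. by apply/eqP => b0; case/andP: hb => ? _; lra. Qed.

(** As b q = 1, multiplying a function by B^(-b) divides its q-th power by [B]. *)
Lemma powRNb (B : R) : 0 < B -> (B `^ (- b)) `^ q = B^-1.
Proof.
move=> B0; rewrite -powRrM hq mulNr div1r divff//.
by rewrite powR_inv1// ltW.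
Qed.

Lemma powRNb_scale (u B : R) : 0 <= u -> 0 < B ->
  (B `^ (- b) * u) `^ q = B^-1 * u `^ q.
Proof. by move=> u0 B0; rewrite powRM ?powR_ge0// powRNb. Qed.

(** The bounded inequality is applied to truncations of B^(-b) g, whose q-th powers have integral at
    most 1, and multiplied back by [B]. *)
Lemma log_sobolev_scaled : exists2 K : R, 0 < K & forall g (B : R),
  locally_lipschitz g -> (forall x, 0 <= g x) -> 0 < B ->
  integ (fun x => g x `^ q) -> \int[mu]_x g x `^ q <= B ->
  integ (fun x => grad g x `^ q) ->
  integ (fun x => g x `^ q * ln (1 + g x `^ q / B)) /\
  \int[mu]_x (g x `^ q * ln (1 + g x `^ q / B)) <=
    K * (B + \int[mu]_x grad g x `^ q).
Proof.
have c0 : 0 < c by exact: hc.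
have [k k0 hk] := Phi_sqrt_le hb.
(* 192 = 24 * 8, for the condition [24 * c * e <= 8^-1]. *)
pose e := (1 + 192 * c)^-1; have e0 : 0 < e by rewrite invr_gt0; lra.
have e01 : 0 < e <= 1 by rewrite e0/= invf_le1; lra.
have ce : 24 * c * e <= 8^-1 by rewrite /e ler_pdivrMr; lra.
set K : R := 4 * k + 96 * (c * e^-1).
have K0 : 0 < K by rewrite addr_gt0// mulr_gt0// divr_gt0.
exists K => // g B gL g0 B0 Ig gB ig.
pose a := B `^ (- b); have a0 : 0 < a by exact: powR_gt0.
pose D := \int[mu]_x grad g x `^ q.
(* This form is nonnegative on the whole line, as the truncation lemma asks, and equals the
   integrand for u >= 0. *)
pose psi u := B * xlogx q (a * u).
have psiE (u : R) : 0 <= u -> psi u = u `^ q * ln (1 + u `^ q / B).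
  by move=> u0; rewrite /psi /xlogx powRNb_scale// [_ / B]mulrC mulrA mulVKf// gt_eqF.
pose h x := g x `^ q * ln (1 + g x `^ q / B).
have hE : h = psi \o g by apply/funext => x; rewrite /= psiE.
change (mu.-integrable setT (EFin \o h) /\ \int[mu]_x h x <= K * (B + D)).
rewrite {}hE.
apply: (Rintegral_truncation_le (psi := psi) gL g0).
- move=> u v; rewrite !nnegrE => u0 v0 uv; rewrite ler_pM2l//.
  by apply: (xlogx_homo hb hq); rewrite ?mulr_ge0 ?(ltW a0)// ler_pM2l.
- by move=> u; rewrite mulr_ge0 ?(ltW B0)//; exact: xlogx_ge0.
- apply: measurable_funM => //.
  apply: (measurableT_comp (measurable_xlogx q)).
  exact: measurable_funM.
move=> n; have [uL gradu un] := trunc_lipschitz n gL g0.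
have [iu hu] := grad_powR_le uL gradu ig.
set u := (fun x => Num.min (g x) n%:R) in uL gradu un iu hu *.
pose v x := a * u x.
have [vL gradv] : locally_lipschitz v /\ forall x, grad v x <= a * grad u x.
  apply: (lipschitz_comp uL (ltW a0)) => x y.
  by rewrite -mulrBr normrM ger0_norm// ltW.
have vM x : 0 <= v x <= a * n%:R.
  have /andP[h1 h2] := un x; rewrite mulr_ge0 ?(ltW a0)//=.
  by rewrite ler_pM2l.
have mv := measurable_locally_lipschitz vL.
have Iu := integrable_powR mu hb hq (measurable_locally_lipschitz uL) un.
have v1 : \int[mu]_x v x `^ q <= 1.
  apply: (@le_trans _ _ (\int[mu]_x (B^-1 * u x `^ q))).
    apply: Rintegral_le; first exact: (integrable_powR mu hb hq mv vM).
      exact: integrable_scale.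
    by move=> x; rewrite powRNb_scale//; case/andP: (un x).
  rewrite (RintegralZl _ measurableT Iu) mulrC ler_pdivrMr// mul1r.
  apply: le_trans gB; apply: (Rintegral_le Iu Ig) => x.
  by apply: le_powR2r => //; [case/andP: (un x)|rewrite /u ge_min lexx].
have gradvq x : 0 <= grad v x `^ q <= B^-1 * grad u x `^ q.
  rewrite powR_ge0/= -powRNb_scale ?grad_ge0//.
  by apply: le_powR2r => //; exact: grad_ge0.
have iv : integ (fun x => grad v x `^ q).
  apply: integrable_le (integrable_scale B^-1 iu) gradvq.
  by apply: (measurableT_comp (@measurable_powR R q)); exact: measurable_grad.
have := xlogx_grad_le hb hc hq hPhi k0 hk vL vM v1 iv e01 ce; rewrite -/K => hX.
have Iv := integrable_xlogx mu hb hq mv vM.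
have -> : \int[mu]_x psi (u x) = B * \int[mu]_x xlogx q (v x).
  by rewrite -(RintegralZl _ measurableT Iv).
have -> : K * (B + D) = B * (K * (1 + B^-1 * D)).
  by field; rewrite gt_eqF.
rewrite ler_pM2l//; apply: le_trans (le_trans _ hX) _.
- apply: (Rintegral_le Iv).
    apply: (integrable_xlogx mu hb hq (M := a * n%:R + 1)).
      exact: measurable_maxr.
    move=> x; have /andP[h1 h2] := vM x.
    by rewrite le_max h1/= ge_max lerDr (le_trans h1 h2) (le_trans h2)// lerDl.
  move=> x; apply: (xlogx_homo hb hq); first by case/andP: (vM x).
  by rewrite le_max lexx.
- rewrite (ler_pM2l K0) lerD2l.
  have Bi : 0 < B^-1 by rewrite invr_gt0.
  apply: (@le_trans _ _ (\int[mu]_x (B^-1 * grad u x `^ q))).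
    apply: (Rintegral_le iv (integrable_scale B^-1 iu)) => x.
    by case/andP: (gradvq x).
  rewrite (RintegralZl _ measurableT iu) (ler_pM2l Bi); exact: hu.
Qed.

End unbounded.

(** * Tight logarithmic Sobolev inequality *)

Section tight_log_sobolev.
Context {R : realType} {T : pointedType} {d : T -> T -> R} (hd : is_metric d).
Context (mu : probability (borel (metrized hd)) R) (b c q : R).
Local Notation X := (metrized hd).

Local Notation integ f := (mu.-integrable setT (fun x : borel X => (f x)%:E)).

Hypotheses (hb : 1 / 2 <= b <= 1) (hc : 0 < c) (hq : q = 1 / b).
Hypothesis hPhi : Phi_ineq mu b c.

Let q_ge1 : 1 <= q.
Proof. by rewrite hq div1r invf_ge1//; case/andP: hb => *; lra. Qed.

Let q_le2 : q <= 2.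
Proof. by rewrite hq div1r invf_ple ?posrE//; case/andP: hb => *; lra. Qed.

Let q_neq0 : q != 0.
Proof. by rewrite gt_eqF// (lt_le_trans ltr01 q_ge1). Qed.

(** At each point one of the positive and negative parts of h - m vanishes, so their q-th powers add
    up to |h - m|^q. Each part is positive on a set of measure at most 1/2 and contributes one
    constant of [poincare]. *)
Lemma poincare_median : exists2 K : R, 0 < K & forall h : X -> R,
  locally_lipschitz h -> (forall x, 0 <= h x) ->
  integ (fun x => grad h x `^ q) ->
  exists2 m : R, 0 <= m &
    integ (fun x => `|h x - m| `^ q) /\
    \int[mu]_x `|h x - m| `^ q <= K * \int[mu]_x grad h x `^ q.
Proof.
have [K K0 hK] := poincare hb hc hq hPhi; exists (2 * K); first by rewrite mulr_gt0.
move=> h hL h0 ih; have mh := measurable_locally_lipschitz hL.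
have [m m0 [P1 P2]] := median_exists mu mh h0; exists m => //.
pose hp (x : X) := Num.max (h x - m) 0; pose hm (x : X) := Num.max (m - h x) 0.
have [pL gradp] : locally_lipschitz hp /\ forall x, grad hp x <= grad h x.
  apply: contraction_comp => // x y; apply: le_trans (maxr_lip _ _ _) _.
  by rewrite opprB addrA subrK.
have [mL gradm] : locally_lipschitz hm /\ forall x, grad hm x <= grad h x.
  apply: contraction_comp => // x y; apply: le_trans (maxr_lip _ _ _) _.
  by rewrite opprB addrC subrKA distrC.
have p0 x : 0 <= hp x by rewrite le_max lexx orbT.
have n0 x : 0 <= hm x by rewrite le_max lexx orbT.
have pA : (mu [set x | (0 < hp x)%R] <= (1 / 2)%:E)%E.
  have -> // : [set x | 0 < hp x] = [set x | m < h x].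
  by apply/seteqP; split=> x /=; rewrite /hp lt_max ltxx orbF subr_gt0.
have nA : (mu [set x | (0 < hm x)%R] <= (1 / 2)%:E)%E.
  have -> // : [set x | 0 < hm x] = [set x | h x < m].
  by apply/seteqP; split=> x /=; rewrite /hm lt_max ltxx orbF subr_gt0.
have [ip hp1] := grad_powR_le hb hq pL gradp ih.
have [im hm1] := grad_powR_le hb hq mL gradm ih.
have [Ip hp2] := hK _ pL p0 pA ip.
have [Im hm2] := hK _ mL n0 nA im.
have pmE x : `|h x - m| `^ q = hp x `^ q + hm x `^ q.
  rewrite /hp /hm; case: (leP (h x) m) => hx.
    rewrite (max_idPr _) ?subr_le0// (max_idPl _) ?subr_ge0// powR0// add0r.
    by rewrite distrC ger0_norm// subr_ge0.
  have hx' := ltW hx.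
  rewrite (max_idPl _) ?subr_ge0// (max_idPr _) ?subr_le0// powR0// addr0.
  by rewrite ger0_norm// subr_ge0.
have -> : (fun x : borel X => (`|h x - m| `^ q)%:E) =
          (fun x => (hp x `^ q + hm x `^ q)%:E) by apply/funext => x; rewrite pmE.
have -> : \int[mu]_x `|h x - m| `^ q = \int[mu]_x (hp x `^ q + hm x `^ q).
  by apply: eq_Rintegral => x _; rewrite pmE.
split; first exact: integrable_add.
rewrite (RintegralD measurableT Ip Im).
have -> : 2 * K * \int[mu]_x grad h x `^ q =
  K * \int[mu]_x grad h x `^ q + K * \int[mu]_x grad h x `^ q by ring.
apply: lerD.
- by apply: (le_trans hp2); rewrite (ler_pM2l K0); exact: hp1.
- by apply: (le_trans hm2); rewrite (ler_pM2l K0); exact: hm1.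
Qed.

Lemma measurable_theta : measurable_fun setT (@theta R).
Proof.
apply: measurable_funD => //; apply: measurable_funB => //.
by apply: measurable_funM => //; exact: measurable_ln.
Qed.

(** [entropy_theta] with c = max (m^q, B) splits the entropy into a part bounded by [theta_shift_le]
    and an affine part of nonpositive integral; 45 = 13 + 32. *)
Lemma entropy_le_shift (h : X -> R) (m B K : R) : locally_lipschitz h ->
  (forall x, 0 <= h x) -> 0 <= m -> 0 < B ->
  integ (fun x => h x `^ q) -> 0 < \int[mu]_x h x `^ q ->
  integ (fun x => `|h x - m| `^ q) -> \int[mu]_x `|h x - m| `^ q <= B ->
  integ (fun x => `|h x - m| `^ q * ln (1 + `|h x - m| `^ q / B)) ->
  \int[mu]_x (`|h x - m| `^ q * ln (1 + `|h x - m| `^ q / B)) <= K ->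
  (\int[mu]_x (h x `^ q * ln (h x `^ q / \int[mu]_y h y `^ q))%:E <=
   (45 * B + 32 * K)%:E)%E.
Proof.
move=> hL h0 m0 B0 Ih A0 Ig gB Il lK.
set A := \int[mu]_y h y `^ q in A0 *.
have mhq : measurable_fun setT (fun x : borel X => h x `^ q).
  by apply: (measurableT_comp (@measurable_powR R q)); exact: measurable_locally_lipschitz.
pose C := Num.max (m `^ q) B; have C0 : 0 < C by rewrite lt_max B0 orbT.
pose S (x : borel X) := C * theta (h x `^ q / C).
pose Z (x : borel X) := `|h x - m| `^ q * ln (1 + `|h x - m| `^ q / B).
have mS : measurable_fun setT S.
  apply: measurable_funM => //; apply: (measurableT_comp measurable_theta).
  exact: measurable_funM.
have IZ : integ (fun x => 13 * B + 32 * (`|h x - m| `^ q + Z x)).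
  apply: integrable_add; first exact: integrable_cst.
  by apply: integrable_scale; exact: integrable_add.
have SZ x : 0 <= S x <= 13 * B + 32 * (`|h x - m| `^ q + Z x).
  rewrite mulr_ge0 ?(ltW C0) ?theta_ge0 ?divr_ge0 ?powR_ge0 ?(ltW C0)//=.
  exact: theta_shift_le.
have IS : integ S by exact: integrable_le mS IZ SZ.
pose L x := (ln (C / A) + 1) * h x `^ q + - C.
have IL : integ L.
  by apply: integrable_add; [exact: integrable_scale|exact: integrable_cst].
have entE x : h x `^ q * ln (h x `^ q / A) = S x + L x.
  by rewrite (entropy_theta (powR_ge0 _ _) A0 C0) /S /L; ring.
have -> : (\int[mu]_x (h x `^ q * ln (h x `^ q / A))%:E =
           \int[mu]_x (S x + L x)%:E)%E.
  by apply: eq_integral => x _; rewrite entE.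
rewrite (RintegralE (integrable_add IS IL)) lee_fin (RintegralD measurableT IS IL).
have intL : \int[mu]_x L x <= 0.
  rewrite (RintegralD measurableT (integrable_scale _ Ih) (integrable_cst mu _)).
  rewrite (RintegralZl _ measurableT Ih) -/A Rintegral_prob_cst.
  (* The bound ln z <= z - 1 at z = C / A gives A ln (C / A) + A - C <= 0. *)
  have : A * ln (C / A) <= A * (C / A - 1).
    by rewrite ler_pM2l//; apply: ln_le_subr1; rewrite divr_gt0.
  rewrite mulrBr mulr1 mulrCA divff ?gt_eqF// mulr1 => h1.
  by rewrite mulrDl mul1r (mulrC (ln _)) -addrA -lerBrDr sub0r opprB.
have intS : \int[mu]_x S x <= 13 * B + 32 * (B + K).
  apply: le_trans (Rintegral_le IS IZ _) _; first by move=> x; case/andP: (SZ x).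
  have Igl := integrable_add Ig Il.
  rewrite (RintegralD measurableT (integrable_cst mu _) (integrable_scale 32 Igl)).
  rewrite Rintegral_prob_cst (RintegralZl _ measurableT Igl) lerD2l ler_pM2l//.
  by rewrite (RintegralD measurableT Ig Il); exact: lerD.
apply: (le_trans (lerD intS intL)); rewrite addr0.
by have -> : 13 * B + 32 * (B + K) = 45 * B + 32 * K by ring.
Qed.

Lemma tight_log_sobolev : exists2 K : R, 0 < K & forall h : X -> R,
  locally_lipschitz h -> (forall x, 0 <= h x) ->
  integ (fun x => h x `^ q) -> 0 < \int[mu]_x h x `^ q ->
  integ (fun x => grad h x `^ q) ->
  (\int[mu]_x (h x `^ q * ln (h x `^ q / \int[mu]_y h y `^ q))%:E <=
   (K * \int[mu]_x grad h x `^ q)%:E)%E.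
Proof.
have [K1 K10 hK1] := poincare_median.
have [K2 K20 hK2] := log_sobolev_scaled hb hc hq hPhi.
have k0 : 0 < 45 + 32 * K2 by rewrite addr_gt0// mulr_gt0.
exists ((45 + 32 * K2) * K1 + 32 * K2).
  by rewrite addr_gt0// mulr_gt0.
move=> h hL h0 Ih A0 ih; have [m m0 [Ig hg]] := hK1 _ hL h0 ih.
set D := \int[mu]_x grad h x `^ q in hg *.
have D0 : 0 <= D by apply: Rintegral_ge0 => x _; exact: powR_ge0.
pose g x := `|h x - m|.
have [gL gradg] : locally_lipschitz g /\ forall x, grad g x <= grad h x.
  apply: contraction_comp => // x y; apply: le_trans (ler_dist_dist _ _) _.
  by rewrite opprB addrA subrK.
have [ig hgD] := grad_powR_le hb hq gL gradg ih.
apply/lee_addgt0Pr => t t0.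
(* [B] must be positive even if D = 0. The extra term is scaled to contribute exactly [t] to 45 B +
   32 K2 (B + D). *)
pose B := K1 * D + t / (45 + 32 * K2).
have B0 : 0 < B by rewrite ltr_wpDl ?divr_gt0// mulr_ge0// ltW.
have gB : \int[mu]_x g x `^ q <= B.
  by apply: le_trans hg _; rewrite lerDl divr_ge0// ltW.
have [Il hl] := hK2 g B gL (fun x => normr_ge0 _) B0 Ig gB ig.
have hlD : K2 * (B + \int[mu]_x grad g x `^ q) <= K2 * (B + D).
  by rewrite (ler_pM2l K20) lerD2l; exact: hgD.
apply: le_trans (entropy_le_shift hL h0 m0 B0 Ih A0 Ig gB Il (le_trans hl hlD)) _.
rewrite -EFinD lee_fin /B.
have -> : 45 * (K1 * D + t / (45 + 32 * K2)) +
    32 * (K2 * (K1 * D + t / (45 + 32 * K2) + D)) =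
    ((45 + 32 * K2) * K1 + 32 * K2) * D + t by field; rewrite gt_eqF.
exact: lexx.
Qed.

End tight_log_sobolev.

Theorem theorem4p1 (R : realType) (N : nat)
  (d : 'rV[R]_N -> 'rV[R]_N -> R) (hd : is_metric d)
  (mu : probability (borel (metrized hd)) R)
  (beta c : R) (hbeta : 1 / 2 <= beta <= 1) (hc : 0 < c)
  (hPhi : forall f : metrized hd -> R,
    locally_lipschitz f ->
    mu.-integrable setT (fun x => (f x)%:E) ->
    (\int[mu]_x grad_length f x < +oo)%E ->
    (\int[mu]_x (Phi beta `|f x|)%:E - (Phi beta (\int[mu]_x `|f x|)%R)%:E
       <= c%:E * \int[mu]_x grad_length f x)%E) :
  let q := 1 / beta in
  exists cq : R, 0 < cq /\
    forall f : metrized hd -> R,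
      locally_lipschitz f ->
      mu.-integrable setT (fun x => (`|f x| `^ q)%:E) ->
      (\int[mu]_x (grad_length f x `^ q) < +oo)%E ->
      (\int[mu]_x (`|f x| `^ q
           * ln (`|f x| `^ q / (\int[mu]_y (`|f y| `^ q))%R))%:E
         <= cq%:E * \int[mu]_x (grad_length f x `^ q))%E.
Proof.
move=> q; have [K K0 hK] := tight_log_sobolev hbeta hc (erefl q) hPhi.
exists K; split=> // f fL Ifq.
have -> : (\int[mu]_x (grad_length f x `^ q) =
           \int[mu]_x (grad f x `^ q)%:E)%E.
  by apply: eq_integral => x _; rewrite (grad_fin _ fL) poweR_EFin.
move=> gfin; have igf : mu.-integrable setT (EFin \o (fun x => grad f x `^ q)).
  apply: integrable_ge0 gfin => [|x]; last exact: powR_ge0.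
  by apply: (measurableT_comp (@measurable_powR R q)); exact: measurable_grad.
pose h (x : metrized hd) := `|f x|.
have [hL gradh] : locally_lipschitz h /\ forall x, grad h x <= grad f x.
  by apply: contraction_comp => // x y; exact: ler_dist_dist.
have h0 x : 0 <= h x by exact: normr_ge0.
have [igh hD] := grad_powR_le hbeta (erefl q) hL gradh igf.
rewrite (RintegralE igf) -EFinM.
have D0 : 0 <= \int[mu]_x grad f x `^ q.
  by apply: Rintegral_ge0 => x _; exact: powR_ge0.
have : 0 <= \int[mu]_y `|f y| `^ q.
  by apply: Rintegral_ge0 => x _; exact: powR_ge0.
rewrite le_eqVlt => /predU1P[<-|A0].
  (* If the mean is 0, division by it returns 0 and [ln 0 = 0], so the left side vanishes. *)
  rewrite (eq_integral (fun=> 0%E)) => [|x _].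
    by rewrite integral0 lee_fin mulr_ge0// ltW.
  by rewrite invr0 mulr0 ln0// mulr0.
apply: le_trans (hK h hL h0 Ifq A0 igh) _.
by rewrite lee_fin (ler_pM2l K0); exact: hD.
Qed.
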